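(* $\mathrm{NE}^{ap}_{\mathcal{O}\cup\mathcal{A}}\equiv_W\mathrm{C}_{\{0,1\}^\mathbb{N}}\times\mathrm{LPO}^*$.
   Context: $f\leq_W g$ iff there are computable partial $K,H$ on $\mathbb{N}^\mathbb{N}$ such that for every realizer $G$ of $g$, $p\mapsto K(\langle p,G(H(p))\rangle)$ realizes $f$; $\equiv_W$ induced equivalence. $\times$ product; $f^*$: $f^0=\mathrm{id}$, $f^{n+1}=f\times f^n$, $f^*(n,x)=f^n(x)$. $\mathrm{LPO}:\{0,1\}^\mathbb{N}\to\{0,1\}$ outputs $1$ iff $p=0^\mathbb{N}$. $\mathcal{O}$: open subsets of $\{0,1\}^\mathbb{N}$, named by enumerations of words $w$ with $U=\bigcup w\{0,1\}^\mathbb{N}$; $\mathcal{A}$: closed sets, named by names of their complements; $\mathcal{O}\cup\mathcal{A}$: named by a tag plus such a name. $\mathrm{C}_{\{0,1\}^\mathbb{N}}$ maps a nonempty closed set to any of its elements. Games: two-player infinite sequential games with choices $\{0,1\}$, turn function $d:\{0,1\}^*\to\{1,2\}$, finitely many outcomes, valuation $v:\{0,1\}^\mathbb{N}\to O$, linear preferences with $\prec_1=\prec_2^{-1}$ (antagonistic). Strategy profiles $s:\{0,1\}^*\to\{0,1\}$; induced play $p_n=s(p_{<n})$; Nash equilibrium: no player can unilaterally change strategy to get a strictly preferred outcome. $\mathrm{NE}^{ap}_\Gamma$ takes such a game, named by the number of outcomes, $d$ and preferences as tables, and for each player and each upper set $U$ of outcomes w.r.t. its preference a $\Gamma$-name of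 $v^{-1}(U)$, and outputs any Nash equilibrium. *)

(* Defs.v *)
From Stdlib Require Import Arith List PeanoNat BinPos.
Import ListNotations.

Definition Baire := nat -> nat.
Definition Cantor := nat -> bool.

Definition join (p q : Baire) : Baire :=
  fun n => if Nat.even n then p (Nat.div2 n) else q (Nat.div2 n).
Definition lft (p : Baire) : Baire := fun n => p (2 * n).
Definition rgt (p : Baire) : Baire := fun n => p (2 * n + 1).

Definition cpair (j n : nat) : nat := (j + n) * (j + n + 1) / 2 + n.
Definition comp (j : nat) (p : Baire) : Baire := fun n => p (cpair j n).
Definition shift (p : Baire) : Baire := fun n => p (S n).

Inductive prog : Type :=
| PZero : prog
| PSucc : prog
| PProj : nat -> prog
| POracle : prog
| PComp : prog -> list prog -> prog
| PPrec : prog -> prog -> prog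
| PMu : prog -> prog.

Inductive eval (p : Baire) : prog -> list nat -> nat -> Prop :=
| eZero xs : eval p PZero xs 0
| eSucc x xs : eval p PSucc (x :: xs) (S x)
| eProj i xs : i < length xs -> eval p (PProj i) xs (nth i xs 0)
| eOracle x xs : eval p POracle (x :: xs) (p x)
| eComp f gs xs ys y :
    Forall2 (fun g y => eval p g xs y) gs ys -> eval p f ys y ->
    eval p (PComp f gs) xs y
| ePrec0 f g xs y : eval p f xs y -> eval p (PPrec f g) (0 :: xs) y
| ePrecS f g n xs r y :
    eval p (PPrec f g) (n :: xs) r -> eval p g (n :: r :: xs) y ->
    eval p (PPrec f g) (S n :: xs) y
| eMu f xs n :
    eval p f (n :: xs) 0 ->
    (forall m, m < n -> exists k, eval p f (m :: xs) (S k)) ->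
    eval p (PMu f) xs n.

Definition pfun := Baire -> option Baire.

Definition computable (F : pfun) : Prop :=
  exists e : prog, forall p q, F p = Some q -> forall n, eval p e [n] (q n).

Record rep := { carrier : Type; named : Baire -> carrier -> Prop }.

(* multi-valued partial functions; dom f = {x | exists y, f x y} *)
Definition problem (X Y : rep) := carrier X -> carrier Y -> Prop.

Definition realizes {X Y : rep} (f : problem X Y) (F : pfun) : Prop :=
  forall p x, named X p x -> (exists y, f x y) ->
    exists q, F p = Some q /\ exists y, f x y /\ named Y q y.

Definition W_le {X Y X' Y' : rep} (f : problem X Y) (g : problem X' Y') : Prop :=
  exists K H : pfun, computable K /\ computable H /\
    forall G : pfun, realizes g G ->
      realizes f (fun p => match H p with
                           | Some q => match G q with
                                       | Some r => K (join p r)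
                                       | None => None
                                       end
                           | None => None
                           end).

Definition W_equiv {X Y X' Y' : rep} (f : problem X Y) (g : problem X' Y') : Prop :=
  W_le f g /\ W_le g f.

Definition prod_rep (X Y : rep) : rep :=
  {| carrier := carrier X * carrier Y;
     named := fun p xy => named X (lft p) (fst xy) /\ named Y (rgt p) (snd xy) |}.

Definition prod_prob {X Y X' Y' : rep} (f : problem X Y) (g : problem X' Y')
  : problem (prod_rep X X') (prod_rep Y Y') :=
  fun x y => f (fst x) (fst y) /\ g (snd x) (snd y).

Definition unit_rep : rep := {| carrier := unit; named := fun _ _ => True |}.

Fixpoint pow_rep (X : rep) (n : nat) : rep :=
  match n with
  | 0 => unit_rep
  | S n => prod_rep X (pow_rep X n)
  end.

Fixpoint pow_prob {X Y : rep} (f : problem X Y) (n : nat)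
  : problem (pow_rep X n) (pow_rep Y n) :=
  match n with
  | 0 => fun x y => y = x
  | S n => prod_prob f (pow_prob f n)
  end.

Definition star_rep (X : rep) : rep :=
  {| carrier := { n : nat & carrier (pow_rep X n) };
     named := fun p nx => lft p 0 = projT1 nx /\
                          named (pow_rep X (projT1 nx)) (rgt p) (projT2 nx) |}.

Inductive star_rel {X Y : rep} (f : problem X Y)
  : carrier (star_rep X) -> carrier (star_rep Y) -> Prop :=
| star_intro n (xs : carrier (pow_rep X n)) (ys : carrier (pow_rep Y n)) :
    pow_prob f n xs ys ->
    star_rel f (existT _ n xs) (existT _ n ys).

Definition star {X Y : rep} (f : problem X Y) : problem (star_rep X) (star_rep Y) :=
  star_rel f.

Definition b2n (b : bool) : nat := if b then 1 else 0.

Definition cantor_rep : rep :=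
  {| carrier := Cantor; named := fun p x => forall n, p n = b2n (x n) |}.

Definition two_rep : rep :=
  {| carrier := bool; named := fun p b => p 0 = b2n b |}.

Definition LPO : problem cantor_rep two_rep :=
  fun x b => b = true <-> (forall n, x n = false).

Fixpoint pos_bits (q : positive) : list bool :=
  match q with
  | xH => []
  | xO q => pos_bits q ++ [false]
  | xI q => pos_bits q ++ [true]
  end.
(* a bijection nat -> {0,1}^* *)
Definition word_of_nat (k : nat) : list bool := pos_bits (Pos.of_succ_nat k).

Definition prefix (w : list bool) (x : Cantor) : Prop :=
  forall i, i < length w -> nth i w false = x i.

(* p enumerates words (p n = 0: nothing, p n = k+1: word number k) *)
Definition open_named (p : Baire) (U : Cantor -> Prop) : Prop :=
  forall x, U x <-> exists n k, p n = S k /\ prefix (word_of_nat k) x.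

Definition closed_named (p : Baire) (A : Cantor -> Prop) : Prop :=
  open_named p (fun x => ~ A x).

Definition OA_named (p : Baire) (S : Cantor -> Prop) : Prop :=
  (p 0 = 0 /\ open_named (shift p) S) \/ (p 0 = 1 /\ closed_named (shift p) S).

Definition closed_rep : rep :=
  {| carrier := Cantor -> Prop; named := closed_named |}.

Definition C_Cantor : problem closed_rep cantor_rep := fun A x => A x.

(* outcomes are 0..nout-1; turn w = true: player 1 moves, false: player 2;
   pref a b = true means a <_1 b (player 1 strictly prefers b to a);
   player 2's preference is the inverse relation. *)
Record game := {
  nout : nat;
  turn : list bool -> bool;
  pref : nat -> nat -> bool;
  val : Cantor -> nat }.

Definition pref_of (G : game) (i : bool) : nat -> nat -> bool :=
  if i then pref G else fun a b => pref G b a.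

Definition strict_linear (k : nat) (lt : nat -> nat -> bool) : Prop :=
  (forall a, a < k -> lt a a = false) /\
  (forall a b c, a < k -> b < k -> c < k -> lt a b = true -> lt b c = true ->
                 lt a c = true) /\
  (forall a b, a < k -> b < k -> a <> b -> lt a b = true \/ lt b a = true).

(* subsets of {0..k-1} coded by m < 2^k *)
Definition upset (k : nat) (lt : nat -> nat -> bool) (m : nat) : Prop :=
  forall a b, a < k -> b < k -> Nat.testbit m a = true -> lt a b = true ->
    Nat.testbit m b = true.

Definition preimage (G : game) (m : nat) : Cantor -> Prop :=
  fun x => Nat.testbit m (val G x) = true.

Definition game_named (Gam : Baire -> (Cantor -> Prop) -> Prop)
  (p : Baire) (G : game) : Prop :=
  strict_linear (nout G) (pref G) /\
  (forall x, val G x < nout G) /\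
  comp 0 p 0 = nout G /\
  (forall k, comp 1 p k = (if turn G (word_of_nat k) then 1 else 2)) /\
  (forall a b, a < nout G -> b < nout G ->
     comp 2 p (cpair a b) = b2n (pref_of G true a b)) /\
  (forall a b, a < nout G -> b < nout G ->
     comp 3 p (cpair a b) = b2n (pref_of G false a b)) /\
  (forall m, m < 2 ^ nout G -> upset (nout G) (pref_of G true) m ->
     Gam (comp m (comp 4 p)) (preimage G m)) /\
  (forall m, m < 2 ^ nout G -> upset (nout G) (pref_of G false) m ->
     Gam (comp m (comp 5 p)) (preimage G m)).

Definition game_rep (Gam : Baire -> (Cantor -> Prop) -> Prop) : rep :=
  {| carrier := game; named := game_named Gam |}.

Definition strategy := list bool -> bool.

Definition strategy_rep : rep :=
  {| carrier := strategy;
     named := fun p s => forall k, p k = b2n (s (word_of_nat k)) |}.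

Fixpoint hist (s : strategy) (n : nat) : list bool :=
  match n with
  | 0 => []
  | S n => hist s n ++ [s (hist s n)]
  end.
Definition play (s : strategy) : Cantor := fun n => s (hist s n).

Definition deviation (G : game) (i : bool) (s s' : strategy) : Prop :=
  forall w, turn G w <> i -> s' w = s w.

Definition nash (G : game) (s : strategy) : Prop :=
  forall (i : bool) (s' : strategy), deviation G i s s' ->
    pref_of G i (val G (play s)) (val G (play s')) = false.

Definition NE_ap (Gam : Baire -> (Cantor -> Prop) -> Prop)
  : problem (game_rep Gam) strategy_rep :=
  fun G s => nash G s.

(* Main.v *)
Require Import Defs.
From Stdlib Require Import Arith List PeanoNat PArith Lia Bool.
From Stdlib Require Import Classical ClassicalEpsilon FunctionalExtensionality.
Import ListNotations.

(* From games to closed choice and LPO.  An equilibrium exists by hypothesis, so no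
   determinacy theorem is needed: a profile is an equilibrium iff, for some outcome a,
   each player's strategy forces an outcome at least as good as a for that player.  For
   every player and outcome set, one LPO instance decides whether the player can force
   the set, by compactness.  If the set is closed, its winning strategies form a closed
   set, which closed choice finds; to be nonempty in every case, it stops shrinking at
   the stage where it would become empty.  If the set is open and can be forced, a
   winning strategy is found by search.

   From closed choice and LPO to games.  In a one-player game the first n moves claim
   which of the n given sequences vanish, and the later moves describe an element of
   the given closed set A.  A false claim and leaving A are both detected at a finite
   stage, and give the worst outcome; otherwise the payoff increases with the set of
   sequences claimed to vanish, so that the optimal play claims exactly the truth. *)

(** * Computable functionals *)

(** The product of problems is parallel: the closed set must be named before any LPO answer is
    known. It therefore holds candidate strategies for all players and outcome sets at once, and the
    answers only tell afterwards which part of it to use. This is why each part must be nonempty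
    even where the set cannot be forced. The instances run over all outcome sets, although the name
    speaks only about upper sets; the constructions make sense for arbitrary sequences, so the
    remaining instances do no harm. Compactness makes one side semidecidable in each case: that a
    closed set cannot be forced, and that an open set can. The tag is part of the name, so the
    reduction knows which of the two an LPO answer refers to. Conversely, one game needs both kinds
    of names: falsification is an open event with the least payoff, so the upper sets of the moving
    player have closed preimages, while those of the idle player have open ones. *)

(* [f] is computed by one program on all argument lists of length [n]; as in de Bruijn
   notation, binders push their variable to the front of the list. *)
Definition R (n : nat) (f : Baire -> list nat -> nat) : Prop :=
  exists e, forall p xs, length xs = n -> eval p e xs (f p xs).

Lemma R_ext n f g :
  (forall p xs, f p xs = g p xs) -> R n f -> R n g.
Proof. intros H [e He]. exists e. intros p xs L. rewrite <- H. auto. Qed.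

Lemma R_hd n : R (S n) (fun _ xs => hd 0 xs).
Proof.
  exists (PProj 0). intros p [|x xs] L; [discriminate|].
  apply (eProj p 0 (x :: xs)); simpl; lia.
Qed.

(** Weakening: a program composed with these projections receives the arguments from position [k]
    on. *)
Lemma Forall2_proj p xs k : k <= length xs ->
  Forall2 (fun g y => eval p g xs y)
    (map PProj (seq k (length xs - k))) (skipn k xs).
Proof.
  remember (length xs - k) as m eqn:E. revert k E.
  induction m as [|m IH]; intros k E Hk.
  - simpl. rewrite skipn_all2 by lia. constructor.
  - simpl. assert (Hn : nth_error xs k = Some (nth k xs 0))
      by (apply nth_error_nth'; lia).
    assert (Hs : skipn k xs = nth k xs 0 :: skipn (S k) xs).
    { clear -Hn. revert k Hn. induction xs as [|a xs IH]; intros [|k] H;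
        simpl in *; try discriminate; [congruence|]. exact (IH k H). }
    rewrite Hs. constructor; [constructor; lia|]. apply IH; lia.
Qed.

Lemma R_tl n f : R n f -> R (S n) (fun p xs => f p (tl xs)).
Proof.
  intros [e He]. exists (PComp e (map PProj (seq 1 n))). intros p xs L.
  apply eComp with (ys := tl xs).
  - assert (H : Forall2 (fun g y => eval p g xs y)
      (map PProj (seq 1 (length xs - 1))) (skipn 1 xs)) by (apply Forall2_proj; lia).
    replace (length xs - 1) with n in H by lia. destruct xs; exact H.
  - apply He. destruct xs; simpl in *; lia.
Qed.

Lemma R_subst n m (f : Baire -> list nat -> nat) (gs : list (Baire -> list nat -> nat)) :
  R m f -> length gs = m -> (forall g, In g gs -> R n g) ->
  R n (fun p xs => f p (map (fun g => g p xs) gs)).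
Proof.
  intros [e He] Hm Hg.
  assert (Hs : exists es, forall p xs, length xs = n ->
    Forall2 (fun g y => eval p g xs y) es (map (fun g => g p xs) gs)).
  { clear -Hg. induction gs as [|g gs IH].
    - exists []. intros. constructor.
    - destruct IH as [es Hes]; [intros; apply Hg; simpl; auto|].
      destruct (Hg g) as [e He]; [simpl; auto|].
      exists (e :: es). intros p xs L. simpl. constructor; auto. }
  destruct Hs as [es Hes]. exists (PComp e es). intros p xs L.
  eapply eComp; [apply Hes; exact L|]. apply He. rewrite length_map. exact Hm.
Qed.

(** Closure under substitution, uniform in the arity [n]. By [closed1] and its analogues it is
    enough to treat the arguments as variables. *)
Definition Closed1 (g : Baire -> nat -> nat) := forall n f1, R n f1 ->
  R n (fun p xs => g p (f1 p xs)).
Definition Closed2 (g : Baire -> nat -> nat -> nat) := forall n f1 f2, R n f1 -> R n f2 ->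
  R n (fun p xs => g p (f1 p xs) (f2 p xs)).
Definition Closed3 (g : Baire -> nat -> nat -> nat -> nat) := forall n f1 f2 f3,
  R n f1 -> R n f2 -> R n f3 ->
  R n (fun p xs => g p (f1 p xs) (f2 p xs) (f3 p xs)).
Definition Closed5 (g : Baire -> nat -> nat -> nat -> nat -> nat -> nat) :=
  forall n f1 f2 f3 f4 f5, R n f1 -> R n f2 -> R n f3 -> R n f4 -> R n f5 ->
  R n (fun p xs => g p (f1 p xs) (f2 p xs) (f3 p xs) (f4 p xs) (f5 p xs)).
Definition Closed6 (g : Baire -> nat -> nat -> nat -> nat -> nat -> nat -> nat) :=
  forall n f1 f2 f3 f4 f5 f6, R n f1 -> R n f2 -> R n f3 -> R n f4 -> R n f5 -> R n f6 ->
  R n (fun p xs => g p (f1 p xs) (f2 p xs) (f3 p xs) (f4 p xs) (f5 p xs) (f6 p xs)).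

Lemma closed1 g : R 1 (fun p xs => g p (hd 0 xs)) -> Closed1 g.
Proof.
  intros H n f1 H1. apply (R_subst n _ _ [f1] H); [reflexivity|].
  simpl; intuition subst; assumption.
Qed.
Lemma closed2 g :
  R 2 (fun p xs => g p (hd 0 xs) (hd 0 (tl xs))) -> Closed2 g.
Proof.
  intros H n f1 f2 H1 H2. apply (R_subst n _ _ [f1; f2] H); [reflexivity|].
  simpl; intuition subst; assumption.
Qed.
Lemma closed3 g :
  R 3 (fun p xs => g p (hd 0 xs) (hd 0 (tl xs)) (hd 0 (tl (tl xs)))) -> Closed3 g.
Proof.
  intros H n f1 f2 f3 H1 H2 H3. apply (R_subst n _ _ [f1; f2; f3] H); [reflexivity|].
  simpl; intuition subst; assumption.
Qed.
Lemma closed5 g :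
  R 5 (fun p xs => g p (hd 0 xs) (hd 0 (tl xs)) (hd 0 (tl (tl xs)))
    (hd 0 (tl (tl (tl xs)))) (hd 0 (tl (tl (tl (tl xs)))))) -> Closed5 g.
Proof.
  intros H n f1 f2 f3 f4 f5 H1 H2 H3 H4 H5.
  apply (R_subst n _ _ [f1; f2; f3; f4; f5] H); [reflexivity|].
  simpl; intuition subst; assumption.
Qed.
Lemma closed6 g :
  R 6 (fun p xs => g p (hd 0 xs) (hd 0 (tl xs)) (hd 0 (tl (tl xs)))
    (hd 0 (tl (tl (tl xs)))) (hd 0 (tl (tl (tl (tl xs)))))
    (hd 0 (tl (tl (tl (tl (tl xs))))))) -> Closed6 g.
Proof.
  intros H n f1 f2 f3 f4 f5 f6 H1 H2 H3 H4 H5 H6.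
  apply (R_subst n _ _ [f1; f2; f3; f4; f5; f6] H); [reflexivity|].
  simpl; intuition subst; assumption.
Qed.

Lemma R_const n c : R n (fun _ _ => c).
Proof.
  induction c as [|c [e He]].
  - exists PZero. intros. constructor.
  - exists (PComp PSucc [e]). intros p xs L.
    apply eComp with (ys := [c]); [|constructor].
    constructor; [apply He; exact L|constructor].
Qed.

Lemma R_S n f : R n f -> R n (fun p xs => S (f p xs)).
Proof.
  apply (closed1 (fun _ => S)). exists PSucc.
  intros p [|x xs] L; [discriminate|]. constructor.
Qed.

Lemma R_rec n b c (st : Baire -> list nat -> nat -> nat -> nat) :
  R n b -> R n c ->
  R (S (S n)) (fun p ys => st p (tl (tl ys)) (hd 0 ys) (hd 0 (tl ys))) ->
  R n (fun p xs => nat_rect (fun _ => nat) (b p xs) (fun k r => st p xs k r) (c p xs)).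
Proof.
  intros [eb Hb] [ec Hc] [es Hs].
  exists (PComp (PPrec eb es) (ec :: map PProj (seq 0 n))). intros p xs L.
  apply eComp with (ys := c p xs :: xs).
  - constructor; [apply Hc; exact L|].
    assert (H : Forall2 (fun g y => eval p g xs y)
      (map PProj (seq 0 (length xs - 0))) (skipn 0 xs)) by (apply Forall2_proj; lia).
    replace (length xs - 0) with n in H by lia. exact H.
  - induction (c p xs) as [|k IH]; simpl.
    + constructor. apply Hb; exact L.
    + eapply ePrecS; [exact IH|].
      apply (Hs p (k :: _ :: xs)). simpl; lia.
Qed.

Lemma R_oracle (n : nat) f : R n f -> R n (fun p xs => p (f p xs)).
Proof.
  apply (closed1 (fun p => p)). exists POracle.
  intros p [|x xs] L; [discriminate|]. constructor.
Qed.

Lemma R_pred n f : R n f -> R n (fun p xs => pred (f p xs)).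
Proof.
  apply (closed1 (fun _ => pred)).
  apply R_ext with (fun p xs => nat_rect (fun _ => nat) 0 (fun k _ => k) (hd 0 xs)).
  - intros p xs. destruct (hd 0 xs); reflexivity.
  - apply R_rec; [apply R_const|apply R_hd|apply R_hd].
Qed.

Lemma R_add n f g : R n f -> R n g -> R n (fun p xs => f p xs + g p xs).
Proof.
  apply (closed2 (fun _ => Nat.add)).
  apply R_ext with (fun p xs => nat_rect (fun _ => nat) (hd 0 (tl xs))
    (fun _ r => S r) (hd 0 xs)).
  - intros p xs. induction (hd 0 xs); simpl; auto.
  - apply R_rec; [apply (R_tl 1 (fun _ xs => hd 0 xs)), R_hd|apply R_hd|].
    apply R_S. apply (R_tl 3 (fun _ xs => hd 0 xs)), R_hd.
Qed.

Lemma R_sub n f g : R n f -> R n g -> R n (fun p xs => f p xs - g p xs).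
Proof.
  apply (closed2 (fun _ => Nat.sub)).
  apply R_ext with (fun p xs => nat_rect (fun _ => nat) (hd 0 xs)
    (fun _ r => pred r) (hd 0 (tl xs))).
  - intros p xs. induction (hd 0 (tl xs)) as [|k IH]; simpl; [lia|]. rewrite IH; lia.
  - apply R_rec; [apply R_hd|apply (R_tl 1 (fun _ xs => hd 0 xs)), R_hd|].
    apply R_pred. apply (R_tl 3 (fun _ xs => hd 0 xs)), R_hd.
Qed.

Lemma R_mul n f g : R n f -> R n g -> R n (fun p xs => f p xs * g p xs).
Proof.
  apply (closed2 (fun _ => Nat.mul)).
  apply R_ext with (fun p xs => nat_rect (fun _ => nat) 0
    (fun _ r => hd 0 (tl xs) + r) (hd 0 xs)).
  - intros p xs. induction (hd 0 xs) as [|k IH]; simpl; auto.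
  - apply R_rec; [apply R_const|apply R_hd|].
    apply (R_add _ (fun p ys => hd 0 (tl (tl (tl ys)))) (fun p ys => hd 0 (tl ys))).
    + apply (R_tl 3 (fun _ xs => hd 0 (tl (tl xs)))),
        (R_tl 2 (fun _ xs => hd 0 (tl xs))), (R_tl 1 (fun _ xs => hd 0 xs)), R_hd.
    + apply (R_tl 3 (fun _ xs => hd 0 xs)), R_hd.
Qed.

(** Programs have no conditional, so it is arithmetised. Evaluating both branches is harmless
    because [R] concerns total functions. *)
Lemma R_if n c f g : R n (fun p xs => b2n (c p xs)) -> R n f -> R n g ->
  R n (fun p xs => if c p xs then f p xs else g p xs).
Proof.
  intros Hc Hf Hg.
  apply R_ext with (fun p xs => b2n (c p xs) * f p xs + (1 - b2n (c p xs)) * g p xs).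
  - intros p xs. destruct (c p xs); simpl; lia.
  - apply R_add; apply R_mul; auto. apply R_sub; auto. apply R_const.
Qed.

Lemma R_b2n_if n c f g : R n (fun p xs => b2n (c p xs)) -> R n (fun p xs => b2n (f p xs)) ->
  R n (fun p xs => b2n (g p xs)) ->
  R n (fun p xs => b2n (if c p xs then f p xs else g p xs)).
Proof.
  intros Hc Hf Hg.
  apply R_ext with (fun p xs => if c p xs then b2n (f p xs) else b2n (g p xs)).
  - intros p xs. destruct (c p xs); reflexivity.
  - apply R_if; assumption.
Qed.

Lemma R_negb n f : R n (fun p xs => b2n (f p xs)) -> R n (fun p xs => b2n (negb (f p xs))).
Proof.
  intros H. apply (R_b2n_if n f (fun _ _ => false) (fun _ _ => true)); auto; apply R_const.
Qed.

Lemma R_andb n f g : R n (fun p xs => b2n (f p xs)) -> R n (fun p xs => b2n (g p xs)) ->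
  R n (fun p xs => b2n (f p xs && g p xs)).
Proof. intros Hf Hg. apply (R_b2n_if n f g (fun _ _ => false)); auto; apply R_const. Qed.

Lemma R_orb n f g : R n (fun p xs => b2n (f p xs)) -> R n (fun p xs => b2n (g p xs)) ->
  R n (fun p xs => b2n (f p xs || g p xs)).
Proof. intros Hf Hg. apply (R_b2n_if n f (fun _ _ => true) g); auto; apply R_const. Qed.

Lemma R_xorb n f g : R n (fun p xs => b2n (f p xs)) -> R n (fun p xs => b2n (g p xs)) ->
  R n (fun p xs => b2n (xorb (f p xs) (g p xs))).
Proof.
  intros Hf Hg. apply R_ext with (fun p xs => b2n (if f p xs then negb (g p xs) else g p xs)).
  - intros p xs. destruct (f p xs), (g p xs); reflexivity.
  - apply R_b2n_if; auto. apply R_negb; auto.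
Qed.

Lemma R_bool_eqb n f g : R n (fun p xs => b2n (f p xs)) -> R n (fun p xs => b2n (g p xs)) ->
  R n (fun p xs => b2n (Bool.eqb (f p xs) (g p xs))).
Proof.
  intros Hf Hg. apply R_ext with (fun p xs => b2n (if f p xs then g p xs else negb (g p xs))).
  - intros p xs. destruct (f p xs), (g p xs); reflexivity.
  - apply R_b2n_if; auto. apply R_negb; auto.
Qed.

Lemma R_leb n f g : R n f -> R n g -> R n (fun p xs => b2n (f p xs <=? g p xs)).
Proof.
  intros Hf Hg. apply R_ext with (fun p xs => 1 - (f p xs - g p xs)).
  - intros p xs. destruct (Nat.leb_spec (f p xs) (g p xs)); cbn [b2n]; lia.
  - apply R_sub; [apply R_const|apply R_sub; auto].
Qed.

Lemma R_ltb n f g : R n f -> R n g -> R n (fun p xs => b2n (f p xs <? g p xs)).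
Proof. intros Hf Hg. apply (R_leb n (fun p xs => S (f p xs)) g); auto. apply R_S; auto. Qed.

Lemma R_eqb n f g : R n f -> R n g -> R n (fun p xs => b2n (f p xs =? g p xs)).
Proof.
  intros Hf Hg. apply R_ext with (fun p xs => b2n ((f p xs <=? g p xs) && (g p xs <=? f p xs))).
  - intros p xs. f_equal. destruct (Nat.leb_spec (f p xs) (g p xs));
      destruct (Nat.leb_spec (g p xs) (f p xs));
      destruct (Nat.eqb_spec (f p xs) (g p xs)); simpl; trivial; lia.
  - apply R_andb; apply R_leb; auto.
Qed.

Ltac rvar := lazymatch goal with
  | |- R _ (fun p xs => hd 0 xs) => apply R_hd
  | |- R (S ?n) (fun p xs => hd 0 (tl xs)) => apply (R_tl n (fun p xs => hd 0 xs)); rvar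
  | |- R (S ?n) (fun p xs => hd 0 (tl (tl xs))) =>
      apply (R_tl n (fun p xs => hd 0 (tl xs))); rvar
  | |- R (S ?n) (fun p xs => hd 0 (tl (tl (tl xs)))) =>
      apply (R_tl n (fun p xs => hd 0 (tl (tl xs)))); rvar
  | |- R (S ?n) (fun p xs => hd 0 (tl (tl (tl (tl xs))))) =>
      apply (R_tl n (fun p xs => hd 0 (tl (tl (tl xs))))); rvar
  | |- R (S ?n) (fun p xs => hd 0 (tl (tl (tl (tl (tl xs)))))) =>
      apply (R_tl n (fun p xs => hd 0 (tl (tl (tl (tl xs)))))); rvar
  | |- R (S ?n) (fun p xs => hd 0 (tl (tl (tl (tl (tl (tl xs))))))) =>
      apply (R_tl n (fun p xs => hd 0 (tl (tl (tl (tl (tl xs))))))); rvar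
  | |- R (S ?n) (fun p xs => hd 0 (tl (tl (tl (tl (tl (tl (tl xs)))))))) =>
      apply (R_tl n (fun p xs => hd 0 (tl (tl (tl (tl (tl (tl xs)))))))); rvar
  end.

(** * Bounded quantifiers and bounded search *)

Fixpoint exb (n : nat) (f : nat -> bool) : bool :=
  match n with 0 => false | S n => f n || exb n f end.
Definition allb (n : nat) (f : nat -> bool) : bool := negb (exb n (fun k => negb (f k))).
(** The search returns the largest witness, as the computation of [Nat.log2] by [R_log2] requires;
    the default 0 agrees with [Nat.log2 0]. *)
Fixpoint findb (n : nat) (f : nat -> bool) : nat :=
  match n with 0 => 0 | S n => if f n then n else findb n f end.

Lemma exb_spec n f : exb n f = true <-> exists k, k < n /\ f k = true.
Proof.
  induction n as [|n IH]; simpl.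
  - split; [discriminate|]. intros (k & H & _); lia.
  - rewrite orb_true_iff, IH. split.
    + intros [H|(k & H & H')]; [exists n|exists k]; split; auto; lia.
    + intros (k & H & H'). destruct (Nat.eq_dec k n) as [->|]; [auto|].
      right. exists k; split; auto; lia.
Qed.

Lemma allb_spec n f : allb n f = true <-> forall k, k < n -> f k = true.
Proof.
  unfold allb. rewrite negb_true_iff, <- not_true_iff_false, exb_spec. split.
  - intros H k Hk. destruct (f k) eqn:E; auto. exfalso. apply H. exists k.
    rewrite E. auto.
  - intros H (k & Hk & E). rewrite (H k Hk) in E. discriminate.
Qed.

Lemma findb_spec n f : (exists k, k < n /\ f k = true) ->
  findb n f < n /\ f (findb n f) = true.
Proof.
  induction n as [|n IH]; intros (k & Hk & E); [lia|]. simpl.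
  destruct (f n) eqn:En; [auto|].
  destruct IH as [H1 H2].
  - exists k. split; auto. destruct (Nat.eq_dec k n); [congruence|lia].
  - split; auto.
Qed.

(** In [R_rec] the counter and the accumulated value stand in front of the parameters, but the
    predicate of a bounded search reads only the counter. *)
Lemma R_drop_second n (f : Baire -> list nat -> nat -> nat) :
  R (S n) (fun p ys => f p (tl ys) (hd 0 ys)) ->
  R (S (S n)) (fun p ys => f p (tl (tl ys)) (hd 0 ys)).
Proof.
  intros [e He].
  exists (PComp e (PProj 0 :: map PProj (seq 2 n))). intros p xs L.
  apply eComp with (ys := hd 0 xs :: tl (tl xs)).
  - assert (H : Forall2 (fun g y => eval p g xs y)
      (map PProj (seq 2 (length xs - 2))) (skipn 2 xs)) by (apply Forall2_proj; lia).
    destruct xs as [|x [|y xs]]; try discriminate. simpl in L.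
    constructor; [apply (eProj p 0 (x :: y :: xs)); simpl; lia|].
    simpl length in H. replace (S (S (length xs)) - 2) with n in H by lia. exact H.
  - apply (He p (hd 0 xs :: tl (tl xs))).
    destruct xs as [|x [|y xs]]; simpl in *; lia.
Qed.

Lemma R_exb n b (f : Baire -> list nat -> nat -> bool) : R n b ->
  R (S n) (fun p ys => b2n (f p (tl ys) (hd 0 ys))) ->
  R n (fun p xs => b2n (exb (b p xs) (f p xs))).
Proof.
  intros Hb Hf.
  apply R_ext with (fun p xs => nat_rect (fun _ => nat) 0
    (fun k r => if f p xs k then 1 else r) (b p xs)).
  - intros p xs. induction (b p xs) as [|k IH]; simpl; auto.
    rewrite IH. destruct (f p xs k); reflexivity.
  - apply R_rec; [apply R_const|exact Hb|].
    apply (R_if _ (fun p ys => f p (tl (tl ys)) (hd 0 ys)) (fun _ _ => 1)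
      (fun _ ys => hd 0 (tl ys))); [|apply R_const|rvar].
    apply (R_drop_second n (fun p xs k => b2n (f p xs k))), Hf.
Qed.

Lemma R_allb n b (f : Baire -> list nat -> nat -> bool) : R n b ->
  R (S n) (fun p ys => b2n (f p (tl ys) (hd 0 ys))) ->
  R n (fun p xs => b2n (allb (b p xs) (f p xs))).
Proof.
  intros Hb Hf. apply R_negb. apply (R_exb n b (fun p xs k => negb (f p xs k))); auto.
  apply R_negb; exact Hf.
Qed.

Lemma R_findb n b (f : Baire -> list nat -> nat -> bool) : R n b ->
  R (S n) (fun p ys => b2n (f p (tl ys) (hd 0 ys))) ->
  R n (fun p xs => findb (b p xs) (f p xs)).
Proof.
  intros Hb Hf.
  apply R_ext with (fun p xs => nat_rect (fun _ => nat) 0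
    (fun k r => if f p xs k then k else r) (b p xs)).
  - intros p xs. induction (b p xs) as [|k IH]; simpl; auto.
    rewrite IH. reflexivity.
  - apply R_rec; [apply R_const|exact Hb|].
    apply (R_if _ (fun p ys => f p (tl (tl ys)) (hd 0 ys)) (fun _ ys => hd 0 ys)
      (fun _ ys => hd 0 (tl ys))); [|rvar|rvar].
    apply (R_drop_second n (fun p xs k => b2n (f p xs k))), Hf.
Qed.

Lemma nat_rect_S b (s : nat -> nat -> nat) k :
  nat_rect (fun _ => nat) b s (S k) = s k (nat_rect (fun _ => nat) b s k).
Proof. reflexivity. Qed.

Lemma R_pow2 n f : R n f -> R n (fun p xs => 2 ^ f p xs).
Proof.
  intros Hf. apply R_ext with (fun p xs => nat_rect (fun _ => nat) 1
    (fun _ r => r + r) (f p xs)).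
  - intros p xs. induction (f p xs) as [|k IH]; simpl; auto. rewrite IH; lia.
  - apply R_rec; [apply R_const|exact Hf|]. apply R_add; rvar.
Qed.

Lemma R_odd n f : R n f -> R n (fun p xs => b2n (Nat.odd (f p xs))).
Proof.
  intros Hf. apply R_ext with (fun p xs => nat_rect (fun _ => nat) 0
    (fun _ r => 1 - r) (f p xs)).
  - intros p xs. induction (f p xs) as [|k IH]; [reflexivity|].
    rewrite nat_rect_S, IH, Nat.odd_succ, <- Nat.negb_odd. destruct (Nat.odd k); reflexivity.
  - apply R_rec; [apply R_const|exact Hf|]. apply R_sub; [apply R_const|rvar].
Qed.

Lemma R_even n f : R n f -> R n (fun p xs => b2n (Nat.even (f p xs))).
Proof.
  intros Hf. apply R_ext with (fun p xs => b2n (negb (Nat.odd (f p xs)))).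
  - intros p xs. rewrite Nat.negb_odd. reflexivity.
  - apply R_negb, R_odd, Hf.
Qed.

Lemma R_div2 n f : R n f -> R n (fun p xs => Nat.div2 (f p xs)).
Proof.
  intros Hf. apply R_ext with (fun p xs => nat_rect (fun _ => nat) 0
    (fun k r => b2n (Nat.odd k) + r) (f p xs)).
  - intros p xs. induction (f p xs) as [|k IH]; [reflexivity|].
    rewrite nat_rect_S, IH. pose proof (Nat.div2_odd k) as H1.
    pose proof (Nat.div2_odd (S k)) as H2.
    rewrite Nat.odd_succ, <- Nat.negb_odd in H2.
    destruct (Nat.odd k); cbn [b2n Nat.b2n negb] in *; lia.
  - apply R_rec; [apply R_const|exact Hf|]. apply R_add; [apply R_odd|]; rvar.
Qed.

Lemma R_shiftr n f g : R n f -> R n g -> R n (fun p xs => Nat.shiftr (f p xs) (g p xs)).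
Proof.
  intros Hf Hg. apply R_ext with (fun p xs => nat_rect (fun _ => nat) (f p xs)
    (fun k r => Nat.div2 r) (g p xs)).
  - intros p xs. induction (g p xs) as [|k IH]; simpl; auto.
  - apply R_rec; [exact Hf|exact Hg|]. apply R_div2; rvar.
Qed.

Lemma R_testbit n f g : R n f -> R n g ->
  R n (fun p xs => b2n (Nat.testbit (f p xs) (g p xs))).
Proof.
  intros Hf Hg. apply R_ext with (fun p xs => b2n (Nat.odd (Nat.shiftr (f p xs) (g p xs)))).
  - intros p xs. rewrite Nat.testbit_odd. reflexivity.
  - apply R_odd, R_shiftr; auto.
Qed.

Lemma R_log2 n f : R n f -> R n (fun p xs => Nat.log2 (f p xs)).
Proof.
  apply (closed1 (fun _ => Nat.log2)).
  apply R_ext with (fun p xs => findb (S (hd 0 xs)) (fun k => 2 ^ k <=? hd 0 xs)).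
  - intros p xs. set (d := hd 0 xs). destruct (Nat.eq_dec d 0) as [E|E].
    + rewrite E. reflexivity.
    + assert (G : forall b, Nat.log2 d < b -> findb b (fun k => 2 ^ k <=? d) = Nat.log2 d).
      { induction b as [|b IH]; intros Hb; [lia|]. cbn [findb].
        destruct (Nat.leb_spec (2 ^ b) d) as [H|H].
        - apply Nat.log2_le_pow2 in H; lia.
        - apply IH. apply Nat.log2_lt_pow2 in H; lia. }
      apply G. pose proof (Nat.log2_lt_lin d). lia.
  - apply R_findb; [apply R_S; rvar|]. apply R_leb; [apply R_pow2; rvar|rvar].
Qed.

Lemma R_half n f : R n f -> R n (fun p xs => f p xs / 2).
Proof.
  intros Hf. apply R_ext with (fun p xs => Nat.div2 (f p xs)).
  - intros. apply Nat.div2_div.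
  - apply R_div2, Hf.
Qed.

Lemma R_cpair n f g : R n f -> R n g -> R n (fun p xs => cpair (f p xs) (g p xs)).
Proof.
  intros Hf Hg. unfold cpair. apply R_add; [|exact Hg].
  apply (R_half n (fun p xs => (f p xs + g p xs) * (f p xs + g p xs + 1))).
  apply R_mul; repeat apply R_add; auto. apply R_const.
Qed.

Definition computes (A : Baire -> Baire) := Closed1 A.

(** Extension point of [rstep], redefined below whenever new functions are known to be
    computable. *)
Ltac rhook := fail.
Ltac rstep :=
  cbv beta;
  first [ assumption | rvar | simple apply R_const |
  lazymatch goal with
  | |- R _ (fun p xs => S _) => apply R_S
  | |- R _ (fun p xs => pred _) => apply R_pred
  | |- R _ (fun p xs => _ + _) => apply R_add
  | |- R _ (fun p xs => _ - _) => apply R_sub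
  | |- R _ (fun p xs => _ * _) => apply R_mul
  | |- R _ (fun p xs => 2 ^ _) => apply R_pow2
  | |- R _ (fun p xs => Nat.div2 _) => apply R_div2
  | |- R _ (fun p xs => Nat.log2 _) => apply R_log2
  | |- R _ (fun p xs => Nat.shiftr _ _) => apply R_shiftr
  | |- R _ (fun p xs => cpair _ _) => apply R_cpair
  | |- R _ (fun p xs => findb _ _) => apply R_findb
  | |- R _ (fun p xs => nat_rect _ _ _ _) => apply R_rec
  | |- R _ (fun p xs => b2n (_ && _)) => apply R_andb
  | |- R _ (fun p xs => b2n (_ || _)) => apply R_orb
  | |- R _ (fun p xs => b2n (negb _)) => apply R_negb
  | |- R _ (fun p xs => b2n (xorb _ _)) => apply R_xorb
  | |- R _ (fun p xs => b2n (Bool.eqb _ _)) => apply R_bool_eqb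
  | |- R _ (fun p xs => b2n (_ <=? _)) => apply R_leb
  | |- R _ (fun p xs => b2n (_ <? _)) => apply R_ltb
  | |- R _ (fun p xs => b2n (_ =? _)) => apply R_eqb
  | |- R _ (fun p xs => b2n (Nat.odd _)) => apply R_odd
  | |- R _ (fun p xs => b2n (Nat.even _)) => apply R_even
  | |- R _ (fun p xs => b2n (Nat.testbit _ _)) => apply R_testbit
  | |- R _ (fun p xs => b2n (exb _ _)) => apply R_exb
  | |- R _ (fun p xs => b2n (allb _ _)) => apply R_allb
  | |- R _ (fun p xs => b2n (if _ then _ else _)) => apply R_b2n_if
  | |- R _ (fun p xs => if _ then _ else _) => apply R_if
  | HA : computes ?A |- R _ (fun p xs => ?A p _) => apply HA
  | |- R _ (fun p xs => p _) => apply R_oracle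
  end
  | rhook ].
Ltac rc := repeat rstep.

Lemma computes_lft A : computes A -> computes (fun p => lft (A p)).
Proof. intros HA. apply closed1. unfold lft. rc. Qed.
Lemma computes_rgt A : computes A -> computes (fun p => rgt (A p)).
Proof. intros HA. apply closed1. unfold rgt. rc. Qed.
Lemma computes_id : computes (fun p => p).
Proof. apply closed1. rc. Qed.

Lemma computable_total F : computes F -> computable (fun p => Some (F p)).
Proof.
  intros H. destruct (H 1 (fun _ xs => hd 0 xs) (R_hd 0)) as [e He].
  exists e. intros p q E n. injection E as <-. apply (He p [n] eq_refl).
Qed.

(** The witness depends on [y] only through the index [h p y]. With the player to move as index, all
    moves of one player come from the same winning strategy; separate searches for each position
    could mix several. *)
Lemma computable_search (f g : Baire -> nat -> nat -> nat) (h : Baire -> nat -> nat) :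
  Closed2 f -> Closed2 g -> Closed1 h ->
  exists K, computable K /\ forall p, (forall y, exists c, f p c (h p y) = 0) ->
    exists q C, K p = Some q /\ forall y,
      f p (C (h p y)) (h p y) = 0 /\ q y = g p (C (h p y)) y.
Proof.
  intros Hf Hg Hh.
  assert (Rf : R 2 (fun p xs => f p (hd 0 xs) (h p (hd 0 (tl xs)))))
    by (apply Hf; [rc|apply Hh; rc]).
  assert (Rg : R 2 (fun p xs => g p (hd 0 xs) (hd 0 (tl xs)))) by (apply Hg; rc).
  destruct Rf as [ef Ef]. destruct Rg as [eg Eg].
  (* Minimality pins down the witness that [PMu] finds. *)
  set (good := fun p q => exists C, forall y, f p (C (h p y)) (h p y) = 0 /\
    (forall m, m < C (h p y) -> f p m (h p y) <> 0) /\ q y = g p (C (h p y)) y).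
  (* The domain of [K] is decided classically; only its values must come from a program. *)
  exists (fun p => match excluded_middle_informative (exists q, good p q) with
                   | left H => Some (proj1_sig (constructive_indefinite_description _ H))
                   | right _ => None end).
  split.
  - exists (PComp eg [PMu ef; PProj 0]). intros p q E n.
    destruct (excluded_middle_informative _) as [H|H]; [|discriminate].
    injection E as <-.
    destruct (constructive_indefinite_description _ H) as [q [C Hq]]. simpl.
    destruct (Hq n) as (E1 & E2 & ->). set (c := C (h p n)) in *.
    apply eComp with (ys := [c; n]); [|apply (Eg p [c; n] eq_refl)].
    constructor; [|constructor; [|constructor]].
    + apply eMu.
      * rewrite <- E1. apply (Ef p [c; n] eq_refl).
      * intros m Hm. exists (pred (f p m (h p n))).
        rewrite Nat.succ_pred by (apply E2; exact Hm). apply (Ef p [m; n] eq_refl).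
    + apply (eProj p 0 [n]); simpl; lia.
  - intros p Hp.
    destruct (excluded_middle_informative (exists q, good p q)) as [H|H].
    + destruct (constructive_indefinite_description _ H) as [q [C Hq]]. exists q, C.
      split; [reflexivity|]. intros y. destruct (Hq y) as (? & _ & ?). auto.
    + exfalso. apply H.
      assert (L : forall i, exists c, (exists c, f p c i = 0) ->
        f p c i = 0 /\ forall m, m < c -> f p m i <> 0).
      { intros i. apply NNPP. intros N.
        assert (Z : forall c, f p c i <> 0); [|apply N; exists 0; intros [c Hc]; destruct (Z c Hc)].
        induction c as [c IH] using lt_wf_ind. intros Hc. apply N. exists c. auto. }
      set (C := fun i => proj1_sig (constructive_indefinite_description _ (L i))).
      exists (fun y => g p (C (h p y)) y), C. intros y. specialize (Hp y).
      unfold C. destruct (constructive_indefinite_description _ (L (h p y))) as [c Hc].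
      simpl. destruct (Hc Hp). auto.
Qed.

(** * Codes of words *)

(* The word coded by [d >= 1] consists of the binary digits of [d] after the leading 1. *)
Fixpoint code (x : Cantor) (L : nat) : nat :=
  match L with 0 => 1 | S L => 2 * code x L + b2n (x L) end.

(** Dropping letters at the end of a word is a right shift of its code, so this is the code of the
    prefix of length [l]. *)
Definition pre (d l : nat) : nat := Nat.shiftr d (Nat.log2 d - l).
Definition bit (d l : nat) : bool := Nat.odd (pre d (S l)).
(** [word_of_nat k] reads the digits of [k + 1], hence the [pred]. A nonzero entry in the name of an
    open set is thus itself the code of the enumerated word, and 0 codes no word. *)
Definition word (d : nat) : list bool := word_of_nat (pred d).

Lemma code_bounds x L : 2 ^ L <= code x L < 2 ^ S L.
Proof. induction L as [|L IH]; simpl in *; [lia|]. destruct (x L); simpl; lia. Qed.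

Lemma code_pos x L : 1 <= code x L.
Proof. induction L as [|L IH]; simpl; lia. Qed.

Lemma log2_code x L : Nat.log2 (code x L) = L.
Proof. apply Nat.log2_unique; [lia|apply code_bounds]. Qed.

Lemma code_gt x L : L < code x L.
Proof.
  pose proof (code_bounds x L). pose proof (Nat.pow_gt_lin_r 2 L). lia.
Qed.

Lemma div2_double_b2n a b : Nat.div2 (2 * a + b2n b) = a.
Proof.
  destruct b; unfold b2n.
  - rewrite Nat.add_1_r. apply Nat.div2_succ_double.
  - rewrite Nat.add_0_r. apply Nat.div2_double.
Qed.

Lemma odd_double_b2n a b : Nat.odd (2 * a + b2n b) = b.
Proof.
  rewrite Nat.odd_add, Nat.odd_mul. destruct b; reflexivity.
Qed.

Lemma div2_odd_b2n a : a = 2 * Nat.div2 a + b2n (Nat.odd a).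
Proof. exact (Nat.div2_odd a). Qed.

Lemma shiftr_code x L t : Nat.shiftr (code x (L + t)) t = code x L.
Proof.
  revert L. induction t as [|t IH]; intros L; [rewrite Nat.add_0_r; reflexivity|].
  change (Nat.div2 (Nat.shiftr (code x (L + S t)) t) = code x L).
  replace (L + S t) with (S L + t) by lia. rewrite IH. apply div2_double_b2n.
Qed.

Lemma pre_code x L l : l <= L -> pre (code x L) l = code x l.
Proof.
  intros H. unfold pre. rewrite log2_code.
  replace (code x L) with (code x (l + (L - l))) by (f_equal; lia). apply shiftr_code.
Qed.

Lemma bit_code x L l : l < L -> bit (code x L) l = x l.
Proof.
  intros H. unfold bit. rewrite pre_code by lia. apply odd_double_b2n.
Qed.

Lemma code_ext x y L : (forall l, l < L -> x l = y l) -> code x L = code y L.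
Proof.
  induction L as [|L IH]; intros H; simpl; auto.
  rewrite IH by (intros; apply H; lia). rewrite (H L) by lia. reflexivity.
Qed.

Lemma code_inj x y L l : code x L = code y L -> l < L -> x l = y l.
Proof. intros E H. rewrite <- (bit_code x L l H), E. apply bit_code, H. Qed.

Lemma code_eq_len x y L M : code x L = code y M -> L = M.
Proof. intros E. rewrite <- (log2_code x L), E. apply log2_code. Qed.

Lemma code_bit_pre d l : 1 <= d -> l <= Nat.log2 d -> code (bit d) l = pre d l.
Proof.
  intros Hd. induction l as [|l IH]; intros Hl.
  - unfold pre. rewrite Nat.sub_0_r, Nat.shiftr_div_pow2.
    assert (Hs := Nat.log2_spec d ltac:(lia)). simpl in Hs.
    apply Nat.div_unique with (d - 2 ^ Nat.log2 d); simpl; lia.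
  - change (2 * code (bit d) l + b2n (bit d l) = pre d (S l)). rewrite IH by lia.
    rewrite (div2_odd_b2n (pre d (S l))). fold (bit d l). do 2 f_equal.
    unfold pre. replace (Nat.log2 d - l) with (S (Nat.log2 d - S l)) by lia. reflexivity.
Qed.

Lemma code_bit d : 1 <= d -> code (bit d) (Nat.log2 d) = d.
Proof.
  intros Hd. rewrite code_bit_pre by lia. unfold pre. rewrite Nat.sub_diag. reflexivity.
Qed.

Lemma code_surj d : 1 <= d -> exists x L, d = code x L.
Proof. intros H. exists (bit d), (Nat.log2 d). symmetry. apply code_bit, H. Qed.

Lemma code_range d L : 2 ^ L <= d < 2 ^ S L -> exists x, d = code x L.
Proof.
  intros H. exists (bit d). assert (E : Nat.log2 d = L) by (apply Nat.log2_unique; lia).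
  rewrite <- E. symmetry. apply code_bit. pose proof (Nat.pow_nonzero 2 L). lia.
Qed.

Lemma code_lt x l L : l < L -> code x l < code x L.
Proof.
  intros H. induction H as [|L H IH]; simpl.
  - pose proof (code_pos x l). lia.
  - pose proof (code_pos x L). lia.
Qed.

Lemma code_le_mono x y L : (forall l, l < L -> x l = true -> y l = true) ->
  code x L <= code y L.
Proof.
  induction L as [|L IH]; intros H; simpl; [lia|].
  specialize (IH ltac:(intros; apply H; auto)).
  specialize (H L ltac:(lia)). destruct (x L), (y L); simpl; try lia.
Qed.

Lemma word_snoc d b : 1 <= d -> word (2 * d + b2n b) = word d ++ [b].
Proof.
  intros H.
  assert (P : forall d, 1 <= d -> Pos.of_succ_nat (pred d) = Pos.of_nat d).
  { intros c Hc. rewrite Pos.of_nat_succ. f_equal. lia. }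
  unfold word, word_of_nat. rewrite !P by (destruct b; simpl; lia).
  replace (Pos.of_nat (2 * d + b2n b)) with (if b then xI (Pos.of_nat d) else xO (Pos.of_nat d)).
  - destruct b; reflexivity.
  - apply Pos2Nat.inj. rewrite Nat2Pos.id by lia.
    destruct b; [rewrite Pos2Nat.inj_xI|rewrite Pos2Nat.inj_xO];
      rewrite Nat2Pos.id by lia; simpl; lia.
Qed.

Lemma word_code x L : word (code x L) = map x (seq 0 L).
Proof.
  induction L as [|L IH]; [reflexivity|].
  change (code x (S L)) with (2 * code x L + b2n (x L)). rewrite word_snoc by apply code_pos.
  rewrite IH, seq_S, map_app. reflexivity.
Qed.

Lemma word_surj w : exists d, 1 <= d /\ word d = w.
Proof.
  induction w as [|b w IH] using rev_ind; [exists 1; auto|].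
  destruct IH as (d & Hd & <-). exists (2 * d + b2n b). split; [lia|]. apply word_snoc, Hd.
Qed.

Lemma word_inj d e : 1 <= d -> 1 <= e -> word d = word e -> d = e.
Proof.
  intros Hd He. destruct (code_surj d Hd) as (x & L & ->).
  destruct (code_surj e He) as (y & M & ->). rewrite !word_code. intros E.
  assert (L = M) as <-.
  { apply (f_equal (@length _)) in E. rewrite !length_map, !length_seq in E. exact E. }
  apply code_ext. intros l Hl. apply (f_equal (fun w => nth l w false)) in E.
  rewrite !(nth_indep _ false (x 0)), map_nth in E
    by (rewrite length_map, length_seq; exact Hl).
  rewrite (nth_indep _ (x 0) (y 0)), map_nth, seq_nth in E
    by (rewrite ?length_map, ?length_seq; exact Hl). exact E.
Qed.

Definition wcode (w : list bool) : nat :=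
  proj1_sig (constructive_indefinite_description _ (word_surj w)).

Lemma word_wcode w : word (wcode w) = w.
Proof. unfold wcode. destruct (constructive_indefinite_description _ _); simpl; tauto. Qed.

Lemma wcode_pos w : 1 <= wcode w.
Proof. unfold wcode. destruct (constructive_indefinite_description _ _); simpl; tauto. Qed.

Lemma wcode_word d : 1 <= d -> wcode (word d) = d.
Proof. intros H. apply word_inj; auto using wcode_pos, word_wcode. Qed.

Lemma prefix_code k x : prefix (word_of_nat k) x <-> exists L, S k = code x L.
Proof.
  change (word_of_nat k) with (word (S k)).
  destruct (code_surj (S k) ltac:(lia)) as (y & L & E). rewrite E. clear E k.
  rewrite word_code. unfold prefix. rewrite length_map, length_seq.
  assert (N : forall i, i < L -> nth i (map y (seq 0 L)) false = y i).
  { intros i Hi. rewrite (nth_indep _ false (y 0)), map_nth, seq_nth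
      by (rewrite ?length_map, ?length_seq; exact Hi). reflexivity. }
  split.
  - intros H. exists L. apply code_ext. intros l Hl. rewrite <- N by exact Hl. auto.
  - intros [M E] i Hi. rewrite N by exact Hi. pose proof (code_eq_len _ _ _ _ E). subst M.
    apply (code_inj _ _ L); auto.
Qed.

Lemma open_named_code p U :
  open_named p U <-> forall x, U x <-> exists n L, p n = code x L.
Proof.
  assert (E : forall x, (exists n k, p n = S k /\ prefix (word_of_nat k) x) <->
    exists n L, p n = code x L).
  { intros x. split.
    - intros (n & k & E & H). apply prefix_code in H. destruct H as [L H].
      exists n, L. congruence.
    - intros (n & L & E). pose proof (code_pos x L). exists n, (pred (p n)). split; [lia|].
      apply prefix_code. exists L. lia. }
  unfold open_named. split; intros H x; rewrite H, E; reflexivity.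
Qed.

Lemma hist_play s n : hist s n = word (code (play s) n).
Proof.
  rewrite word_code. induction n as [|n IH]; [reflexivity|].
  rewrite seq_S, map_app, <- IH. reflexivity.
Qed.

Lemma play_code s n : play s n = s (word (code (play s) n)).
Proof. unfold play at 1. rewrite hist_play. reflexivity. Qed.

Lemma length_word_code x L : length (word (code x L)) = L.
Proof. rewrite word_code, length_map, length_seq. reflexivity. Qed.

Lemma play_unique s x : (forall l, x l = s (word (code x l))) -> play s = x.
Proof.
  intros H. assert (E : forall L, code (play s) L = code x L).
  { induction L as [|L IH]; simpl; auto. rewrite play_code, IH, <- H. reflexivity. }
  apply functional_extensionality. intros l. rewrite play_code, E. auto.
Qed.

(** All compactness arguments below rest on this. The branch runs through nodes that have extensions
    in the tree of every length. *)
Lemma koenig (T : nat -> Prop) :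
  (forall L, exists x, T (code x L)) ->
  (forall x L, T (code x (S L)) -> T (code x L)) ->
  exists x, forall L, T (code x L).
Proof.
  intros Hinf Hpre.
  assert (Hle : forall x l L, l <= L -> T (code x L) -> T (code x l)).
  { intros x l L H. induction H; auto. }
  set (Extend := fun x l => forall L, l <= L ->
    exists y, (forall i, i < l -> y i = x i) /\ T (code y L)).
  (* Otherwise each of the two letters fails at some depth, and no extension of [x] reaches the
     larger depth. *)
  assert (Hstep : forall x l, Extend x l -> exists b,
    Extend (fun i => if i <? l then x i else b) (S l)).
  { intros x l H. apply NNPP. intros N.
    assert (F : forall b, exists L, S l <= L /\ forall y, (forall i, i < l -> y i = x i) ->
      y l = b -> ~ T (code y L)).
    { intros b. apply NNPP. intros M. apply N. exists b. intros L HL.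
      apply NNPP. intros K. apply M. exists L. split; auto. intros y Hy Hb HT.
      apply K. exists y. split; auto. intros i Hi.
      destruct (Nat.ltb_spec i l); [auto|]. replace i with l by lia. exact Hb. }
    destruct (F true) as (L1 & H1 & F1). destruct (F false) as (L2 & H2 & F2).
    destruct (H (max L1 L2)) as (y & Hy & HT); [lia|].
    destruct (y l) eqn:E.
    - apply (F1 y Hy E). apply Hle with (max L1 L2); auto; lia.
    - apply (F2 y Hy E). apply Hle with (max L1 L2); auto; lia. }
  set (next := fun x l => if excluded_middle_informative
    (Extend (fun i => if i <? l then x i else true) (S l)) then true else false).
  set (g := fix g (l : nat) : Cantor := match l with 0 => fun _ => false
    | S l => fun i => if i <? l then g l i else next (g l) l end).
  assert (Hg : forall l, Extend (g l) l).
  { induction l as [|l IH].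
    - intros L _. destruct (Hinf L) as [x Hx]. exists x. split; auto. intros; lia.
    - simpl. unfold next. destruct (excluded_middle_informative _) as [|N]; auto.
      destruct (Hstep _ _ IH) as [[] Hb]; [contradiction|exact Hb]. }
  set (x := fun l => g (S l) l).
  assert (Hx : forall l i, i < l -> g l i = x i).
  { induction l as [|l IH]; intros i Hi; [lia|].
    destruct (Nat.eq_dec i l) as [->|]; [reflexivity|].
    simpl. destruct (Nat.ltb_spec i l); [auto|lia]. }
  exists x. intros L. destruct (Hg L L) as (y & Hy & HT); [lia|].
  replace (code x L) with (code y L); [exact HT|]. apply code_ext.
  intros i Hi. rewrite Hy by exact Hi. auto.
Qed.

(** * Pairings *)

Lemma pow2_odd_inj j t j' t' : 2 ^ j * (2 * t + 1) = 2 ^ j' * (2 * t' + 1) -> j = j' /\ t = t'.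
Proof.
  revert j'. induction j as [|j IH]; intros [|j'] H; simpl in H.
  - lia.
  - pose proof (Nat.pow_nonzero 2 j'). lia.
  - lia.
  - destruct (IH j') as [-> ->]; [lia|auto].
Qed.

(* The position of entry [e] of component [j] in the nested pairs of [pow_rep]. *)
Definition slot (j e : nat) : nat := 2 ^ S j * e + pred (2 ^ j).

(** The unique form of a positive number as a power of two times an odd number makes [slot]
    injective. *)
Lemma S_slot j e : S (slot j e) = 2 ^ j * (2 * e + 1).
Proof. unfold slot. pose proof (Nat.pow_nonzero 2 j). simpl. lia. Qed.

Lemma slot_inj j e j' e' : slot j e = slot j' e' -> j = j' /\ e = e'.
Proof. intros H. apply pow2_odd_inj. rewrite <- !S_slot. auto. Qed.

Lemma slot_0 e : slot 0 e = 2 * e.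
Proof. unfold slot. simpl. lia. Qed.

Lemma slot_S j e : slot (S j) e = 2 * slot j e + 1.
Proof. apply Nat.succ_inj. rewrite S_slot. pose proof (S_slot j e). simpl. lia. Qed.

Lemma slot_bounds j e : j <= slot j e /\ e <= slot j e.
Proof.
  induction j as [|j IH]; [rewrite slot_0; lia|]. rewrite slot_S. lia.
Qed.

Lemma even_double n : Nat.even (2 * n) = true.
Proof. apply Nat.even_spec. exists n. reflexivity. Qed.
Lemma even_double_1 n : Nat.even (2 * n + 1) = false.
Proof. rewrite <- Nat.negb_odd. change 1 with (b2n true). rewrite odd_double_b2n. reflexivity. Qed.
Lemma div2_double_1 n : Nat.div2 (2 * n + 1) = n.
Proof. exact (div2_double_b2n n true). Qed.

Lemma lft_join p q : lft (join p q) = p.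
Proof.
  apply functional_extensionality. intros n. unfold lft, join.
  rewrite even_double, Nat.div2_double. reflexivity.
Qed.
Lemma rgt_join p q : rgt (join p q) = q.
Proof.
  apply functional_extensionality. intros n. unfold rgt, join.
  rewrite even_double_1, div2_double_1. reflexivity.
Qed.

Lemma cpair_double j n : 2 * cpair j n = (j + n) * (j + n + 1) + 2 * n.
Proof.
  unfold cpair. assert (E : exists k, (j + n) * (j + n + 1) = 2 * k).
  { destruct (Nat.Even_or_Odd (j + n)) as [[k ->]|[k ->]].
    - exists (k * (2 * k + 1)). lia.
    - exists ((2 * k + 1) * (k + 1)). lia. }
  destruct E as [k E]. rewrite E, (Nat.mul_comm 2 k), Nat.div_mul by lia. lia.
Qed.

Lemma cpair_bounds j n : j <= cpair j n /\ n <= cpair j n.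
Proof.
  pose proof (cpair_double j n). nia.
Qed.

Lemma cpair_inj j n j' n' : cpair j n = cpair j' n' -> j = j' /\ n = n'.
Proof.
  intros E. pose proof (cpair_double j n) as H. pose proof (cpair_double j' n') as H'.
  rewrite E in H. rewrite H' in H.
  assert (j + n = j' + n'); [|nia].
  destruct (Nat.lt_trichotomy (j + n) (j' + n')) as [L|[L|L]]; auto; exfalso; nia.
Qed.

(** Bounded search makes the projections visibly computable; the bound suffices because a pair is at
    least as large as its components. *)
Definition fstp (z : nat) : nat :=
  findb (S z) (fun j => exb (S z) (fun n => cpair j n =? z)).
Definition sndp (z : nat) : nat :=
  findb (S z) (fun n => exb (S z) (fun j => cpair j n =? z)).

Lemma fstp_cpair j n : fstp (cpair j n) = j.
Proof.
  unfold fstp. set (f := fun _ => _). pose proof (cpair_bounds j n).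
  destruct (findb_spec (S (cpair j n)) f) as [_ H1].
  - exists j. split; [lia|]. apply exb_spec. exists n. split; [lia|]. apply Nat.eqb_refl.
  - apply exb_spec in H1. destruct H1 as (m & _ & E). apply Nat.eqb_eq, cpair_inj in E. tauto.
Qed.

Lemma sndp_cpair j n : sndp (cpair j n) = n.
Proof.
  unfold sndp. set (f := fun _ => _). pose proof (cpair_bounds j n).
  destruct (findb_spec (S (cpair j n)) f) as [_ H1].
  - exists n. split; [lia|]. apply exb_spec. exists j. split; [lia|]. apply Nat.eqb_refl.
  - apply exb_spec in H1. destruct H1 as (m & _ & E). apply Nat.eqb_eq, cpair_inj in E. tauto.
Qed.

(** * Finite products of LPO *)

Lemma pow_named_shift X n q xs : named (pow_rep X (S n)) q xs <->
  named X (fun t => q (slot 0 t)) (fst xs) /\ named (pow_rep X n) (rgt q) (snd xs).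
Proof.
  replace (fun t => q (slot 0 t)) with (lft q); [reflexivity|].
  apply functional_extensionality. intros t. rewrite slot_0. reflexivity.
Qed.

Lemma rgt_slot (q : Baire) j e : rgt q (slot j e) = q (slot (S j) e).
Proof. unfold rgt. rewrite slot_S. reflexivity. Qed.

(** LPO on the level of names, free of the dependent types of [pow_rep]. *)
Definition LPO_answer (b : nat) (p : Baire) : Prop :=
  b = 1 /\ (forall t, p t = 0) \/ b = 0 /\ exists t, p t <> 0.

Lemma LPO_answer_iff p x q b : named cantor_rep p x -> q 0 = b2n b ->
  LPO x b <-> LPO_answer (q 0) p.
Proof.
  intros Hp ->. unfold LPO, LPO_answer. simpl in Hp.
  assert (E : (forall n, x n = false) <-> forall t, p t = 0).
  { split; intros H t; specialize (H t); rewrite ?Hp in *; destruct (x t); auto; discriminate. }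
  rewrite E. destruct b; simpl.
  - split; [left; tauto|]. intros [[_ H]|[H _]]; [tauto|discriminate].
  - split; [|intros [[H _]|[_ [t H]]]; [discriminate|]].
    + intros H. right. split; auto. apply not_all_ex_not. intros N.
      apply H in N. discriminate.
    + split; [discriminate|]. intros K. destruct (H (K t)).
Qed.

(** Flattens the nested product. From right to left it reads the answers of an oracle for LPO, from
    left to right it presents answers obtained from a game. *)
Lemma pow_LPO_answers n q q' xs : named (pow_rep cantor_rep n) q xs ->
  (forall j, j < n -> LPO_answer (q' (slot j 0)) (fun t => q (slot j t))) <->
  exists ys, pow_prob LPO n xs ys /\ named (pow_rep two_rep n) q' ys.
Proof.
  revert q q' xs. induction n as [|n IH]; intros q q' xs Hq.
  - split; [|intros; lia]. intros _. exists xs. split; [reflexivity|exact I].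
  - apply pow_named_shift in Hq. destruct Hq as [H0 HS].
    specialize (IH (rgt q) (rgt q') (snd xs) HS). split.
    + intros H. destruct IH as [IH _]. destruct IH as (ys & P & N).
      { intros j Hj. specialize (H (S j) ltac:(lia)). rewrite rgt_slot.
        replace (fun t => rgt q (slot j t)) with (fun t => q (slot (S j) t)); [exact H|].
        apply functional_extensionality. intros; symmetry; apply rgt_slot. }
      specialize (H 0 ltac:(lia)).
      assert (B : exists b, q' (slot 0 0) = b2n b).
      { destruct H as [[-> _]|[-> _]]; [exists true|exists false]; reflexivity. }
      destruct B as [b Hb]. exists (b, ys). split.
      * split; [|exact P].
        apply (LPO_answer_iff _ _ (fun t => q' (slot 0 t)) b H0 Hb). exact H.
      * apply pow_named_shift. split; [exact Hb|exact N].
    + intros ((b & ys) & [P PS] & N) j Hj. apply pow_named_shift in N.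
      destruct N as [N0 NS]. simpl in P, PS, N0, NS. destruct j as [|j].
      * apply (LPO_answer_iff _ _ (fun t => q' (slot 0 t)) b H0 N0). exact P.
      * destruct IH as [_ IH]. specialize (IH ltac:(exists ys; auto) j ltac:(lia)).
        rewrite rgt_slot in IH.
        replace (fun t => q (slot (S j) t)) with (fun t => rgt q (slot j t)); [exact IH|].
        apply functional_extensionality. intros; apply rgt_slot.
Qed.

Lemma pow_cantor_named n q : (forall y, q y <= 1) -> exists xs, named (pow_rep cantor_rep n) q xs.
Proof.
  revert q. induction n as [|n IH]; intros q H; [exists tt; exact I|].
  destruct (IH (rgt q)) as [xs Hx]; [intros; apply H|].
  exists ((fun t => q (slot 0 t) =? 1), xs). apply pow_named_shift. split; [|exact Hx].
  intros t. simpl. specialize (H (slot 0 t)).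
  destruct (Nat.eqb_spec (q (slot 0 t)) 1); simpl; lia.
Qed.

Lemma pow_LPO_total n xs : exists ys, pow_prob LPO n xs ys.
Proof.
  induction n as [|n IH]; [exists xs; reflexivity|].
  destruct xs as [x xs]. destruct (IH xs) as [ys H].
  exists ((if excluded_middle_informative (forall t, x t = false) then true else false), ys).
  split; [|exact H]. simpl. unfold LPO.
  destruct (excluded_middle_informative _); split; auto; discriminate.
Qed.

(** * Finite approximations of winning strategies *)

(* In the name [q] of a game, [enum q i m] is the name of the preimage of the
   outcome set [m], for player 1 if [i = 0] and player 2 if [i = 1]; its first entry
   is the tag, which is 1 for closed sets. *)
Definition enum (q : Baire) (i m t : nat) : nat := q (cpair (4 + i) (cpair m t)).
Definition en (q : Baire) (i m j : nat) : nat := enum q i m (S j).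
Definition turnb (q : Baire) (i d : nat) : bool := q (cpair 1 (pred d)) =? S i.

Definition follows (q : Baire) (i : nat) (S : nat -> bool) (x : Cantor) (L : nat) : Prop :=
  forall l, l < L -> turnb q i (code x l) = true -> S (code x l) = x l.

(* A finite word, coded by [N], is read as a partial strategy which at position [e]
   plays letter number [a * e + b] of the word. *)
Definition consb (q : Baire) (i a b N d : nat) : bool :=
  allb (Nat.log2 d) (fun l =>
    negb (turnb q i (pre d l)) || Bool.eqb (bit N (a * pre d l + b)) (bit d l)).

(** Meant for a closed set, where [en] enumerates the complement: by stage [L] a word of the
    complement has appeared that is consistent with [S]. The bound [code x l <= L] makes this depend
    only on the first [L] values of [S]. *)
Definition violates (q : Baire) (i m : nat) (S : nat -> bool) (L : nat) : Prop :=
  exists j x l, j < L /\ en q i m j = code x l /\ code x l <= L /\ follows q i S x l.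
Definition violb (q : Baire) (i m a b N L : nat) : bool :=
  exb L (fun j => (1 <=? en q i m j) && (en q i m j <=? L) && consb q i a b N (en q i m j)).

(** The numbers from [2 ^ L] to [2 ^ S L - 1] code the words of length [L], that is, all strategies
    that stage [L] can tell apart. *)
Definition emptyb (q : Baire) (i m L : nat) : bool :=
  allb (2 ^ S L) (fun N => negb (2 ^ L <=? N) || violb q i m 1 0 N L).

(** The number [c] is both the code of a partial strategy and a bound for the depth [n], so that one
    unbounded search over [c] suffices. At depth [n], each consistent word must have a prefix among
    the first [n] entries. *)
Definition openb (q : Baire) (i m c : nat) : bool :=
  exb (S c) (fun n => allb (2 ^ S n) (fun d => negb (2 ^ n <=? d) ||
    (negb (consb q i 1 0 c d) ||
     exb n (fun j => exb (S n) (fun l => pre d l =? en q i m j))))).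

Lemma consb_code q i a b N x L :
  consb q i a b N (code x L) = true <-> follows q i (fun e => bit N (a * e + b)) x L.
Proof.
  unfold consb, follows. rewrite allb_spec, log2_code.
  split; intros H l Hl; specialize (H l Hl); rewrite ?pre_code, ?bit_code in * by lia.
  - intros T. rewrite T in H. apply eqb_prop in H. exact H.
  - destruct (turnb q i (code x l)); [|reflexivity]. simpl. apply eqb_true_iff. auto.
Qed.

Lemma follows_ext q i S S' x L : (forall e, e < code x L -> S e = S' e) ->
  follows q i S x L -> follows q i S' x L.
Proof.
  intros E H l Hl T. rewrite <- E; [apply H; assumption|]. apply code_lt, Hl.
Qed.

Lemma violb_spec q i m a b N L :
  violb q i m a b N L = true <-> violates q i m (fun e => bit N (a * e + b)) L.
Proof.
  unfold violb, violates. rewrite exb_spec. split.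
  - intros (j & Hj & H). rewrite !andb_true_iff, !Nat.leb_le in H.
    destruct H as [[H1 H2] H3]. destruct (code_surj _ H1) as (x & l & E).
    rewrite E in *. apply consb_code in H3. exists j, x, l. auto.
  - intros (j & x & l & Hj & E & H1 & H2). exists j. split; auto.
    rewrite E, !andb_true_iff, !Nat.leb_le. repeat split; auto using code_pos.
    apply consb_code, H2.
Qed.

Lemma violates_ext q i m S S' L : (forall e, e < L -> S e = S' e) ->
  violates q i m S L -> violates q i m S' L.
Proof.
  intros E (j & x & l & Hj & H1 & H2 & H3). exists j, x, l. repeat split; auto.
  apply follows_ext with S; auto. intros e He. apply E. lia.
Qed.

Lemma violates_mono q i m S L L' : L <= L' -> violates q i m S L -> violates q i m S L'.
Proof.
  intros HL (j & x & l & Hj & H1 & H2 & H3). exists j, x, l. repeat split; auto; lia.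
Qed.

Lemma emptyb_spec q i m L : emptyb q i m L = true <-> forall S, violates q i m S L.
Proof.
  unfold emptyb. rewrite allb_spec. split.
  - intros H S. pose proof (code_bounds S L) as B. specialize (H (code S L) (proj2 B)).
    apply orb_true_iff in H. destruct H as [H|H].
    + apply negb_true_iff, Nat.leb_gt in H. lia.
    + apply violb_spec in H. eapply violates_ext; [|exact H]. intros e He.
      cbv beta. rewrite bit_code by lia. f_equal. lia.
  - intros H N _. apply orb_true_iff. right. apply violb_spec, H.
Qed.

Lemma emptyb_false q i m L : emptyb q i m L = false <-> exists S, ~ violates q i m S L.
Proof.
  rewrite <- not_true_iff_false, emptyb_spec. split.
  - apply not_all_ex_not.
  - intros [S H] K. exact (H (K S)).
Qed.

(* Once the approximation is seen to be empty, nothing more is removed: the closed set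
   of winning strategies is replaced by one that is always nonempty. *)
Lemma truncation_nonempty q i m :
  exists S, forall L, emptyb q i m L = false -> ~ violates q i m S L.
Proof.
  destruct (classic (exists L, emptyb q i m L = true)) as [[L0 H0]|N].
  - assert (Hmin : exists L, emptyb q i m L = true /\
      forall M, M < L -> emptyb q i m M = false).
    { revert H0. induction L0 as [L IH] using lt_wf_ind. intros H.
      destruct (classic (exists M, M < L /\ emptyb q i m M = true)) as [(M & HM & E)|N].
      - exact (IH M HM E).
      - exists L. split; auto. intros M HM. apply not_true_iff_false. intros E.
        apply N. eauto. }
    destruct Hmin as (L & H & Hlt).
    (* Stage 0 looks at no entry of the enumeration, so it cannot be empty. *)
    destruct L as [|L].
    + exfalso. rewrite emptyb_spec in H. destruct (H (fun _ => false)) as (j & x & l & Hj & _). lia.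
    + destruct (proj1 (emptyb_false q i m L)) as [S HS]; [apply Hlt; lia|].
      (* [S] survives the last nonempty stage, hence the earlier ones; from the next stage on the
         approximations are empty and nothing is required. *)
      exists S. intros M HM V. apply HS.
      apply violates_mono with M; auto.
      destruct (Nat.le_gt_cases M L) as [|G]; auto. exfalso.
      apply not_true_iff_false in HM. apply HM. apply emptyb_spec. intros S'.
      apply violates_mono with (Datatypes.S L); [lia|]. apply emptyb_spec, H.
  - set (T := fun d => ~ violates q i m (bit d) (Nat.log2 d)).
    assert (HT : forall x L, T (code x L) <-> ~ violates q i m x L).
    { intros x L. unfold T. rewrite log2_code.
      split; intros H V; apply H; eapply violates_ext; try exact V;
        intros e He; cbv beta; rewrite bit_code by lia; reflexivity. }
    destruct (koenig T) as [x Hx].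
    + intros L. destruct (proj1 (emptyb_false q i m L)) as [S HS].
      * apply not_true_iff_false. eauto.
      * exists S. apply HT, HS.
    + intros x L. rewrite !HT. intros H V. apply H. apply violates_mono with L; auto.
    + exists x. intros L _. apply HT, Hx.
Qed.

Lemma closed_sound q i m S : (forall L, ~ violates q i m S L) ->
  forall x, (forall L, follows q i S x L) -> ~ exists n L, en q i m n = code x L.
Proof.
  intros H x Hx (n & L & E). apply (H (max (1 + n) (code x L))).
  exists n, x, L. repeat split; auto; lia.
Qed.

(** A consistent word in the complement would extend to a consistent play: both players move along
    the word [y] up to its length [l], and by [S] afterwards. *)
Lemma closed_complete q i m S :
  (forall x, (forall L, follows q i S x L) -> ~ exists n L, en q i m n = code x L) ->
  forall L, ~ violates q i m S L.
Proof.
  intros H L (j & y & l & _ & E & _ & F).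
  set (s := fun w => if length w <? l then y (length w) else S (wcode w)).
  assert (Hs : forall k, play s k = if k <? l then y k else S (code (play s) k)).
  { intros k. rewrite play_code at 1. unfold s at 1. rewrite length_word_code.
    rewrite wcode_word by apply code_pos. reflexivity. }
  assert (Ey : forall k, k <= l -> code (play s) k = code y k).
  { intros k Hk. apply code_ext. intros e He. rewrite Hs.
    destruct (Nat.ltb_spec e l); [reflexivity|lia]. }
  apply (H (play s)).
  - intros M k _ T. rewrite Hs. destruct (Nat.ltb_spec k l) as [Hk|Hk]; [|reflexivity].
    rewrite Ey in * by lia. apply F; auto.
  - exists j, l. rewrite Ey by lia. exact E.
Qed.

Lemma openb_spec q i m c : openb q i m c = true <->
  exists n, n <= c /\ forall x, follows q i (fun e => bit c (1 * e + 0)) x n ->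
    exists j l, j < n /\ l <= n /\ code x l = en q i m j.
Proof.
  unfold openb. rewrite exb_spec.
  split; intros (n & Hn & H); exists n; (split; [lia|]).
  - intros x Hx. pose proof (code_bounds x n) as B.
    rewrite allb_spec in H. specialize (H _ (proj2 B)).
    rewrite !orb_true_iff, !negb_true_iff, Nat.leb_gt in H.
    destruct H as [H|[H|H]]; [lia| |].
    + apply consb_code in Hx. congruence.
    + apply exb_spec in H. destruct H as (j & Hj & H).
      apply exb_spec in H. destruct H as (l & Hl & H). apply Nat.eqb_eq in H.
      rewrite pre_code in H by lia. exists j, l. repeat split; auto; lia.
  - apply allb_spec. intros d Hd. rewrite !orb_true_iff, !negb_true_iff, Nat.leb_gt.
    destruct (Nat.lt_ge_cases d (2 ^ n)) as [|Hd']; [auto|right].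
    destruct (code_range d n) as [x ->]; [auto|].
    destruct (consb q i 1 0 c (code x n)) eqn:E; [right|auto].
    apply consb_code in E. destruct (H x E) as (j & l & Hj & Hl & Ej).
    apply exb_spec. exists j. split; auto. apply exb_spec. exists l. split; [lia|].
    rewrite pre_code by lia. apply Nat.eqb_eq, Ej.
Qed.

Lemma open_sound q i m c : openb q i m c = true ->
  forall x, (forall L, follows q i (bit c) x L) -> exists n L, en q i m n = code x L.
Proof.
  intros H x Hx. apply openb_spec in H. destruct H as (n & _ & H).
  destruct (H x) as (j & l & _ & _ & E); [|eauto].
  apply follows_ext with (bit c); auto. intros e _. f_equal. lia.
Qed.

(** The words consistent with [S] that are not yet covered form a tree. An infinite branch would be
    a consistent play outside the open set, so some level [n] of the tree is empty. *)
Lemma open_complete q i m S :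
  (forall x, (forall L, follows q i S x L) -> exists n L, en q i m n = code x L) ->
  exists c, openb q i m c = true.
Proof.
  intros H.
  set (T := fun d => follows q i S (bit d) (Nat.log2 d) /\
    forall j l, j < Nat.log2 d -> l <= Nat.log2 d -> pre d l <> en q i m j).
  assert (HT : forall x L, T (code x L) <-> follows q i S x L /\
    forall j l, j < L -> l <= L -> code x l <> en q i m j).
  { intros x L. unfold T. rewrite log2_code.
    assert (E : forall l, l <= L -> code (bit (code x L)) l = code x l).
    { intros l Hl. rewrite code_bit_pre by (rewrite ?log2_code; auto using code_pos).
      apply pre_code, Hl. }
    split; intros [H1 H2]; split.
    - intros l Hl. specialize (H1 l Hl). rewrite E, bit_code in H1 by lia. exact H1.
    - intros j l Hj Hl. specialize (H2 j l Hj Hl). rewrite pre_code in H2; auto.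
    - intros l Hl. specialize (H1 l Hl). rewrite E, bit_code by lia. exact H1.
    - intros j l Hj Hl. specialize (H2 j l Hj Hl). rewrite pre_code; auto. }
  assert (Hn : exists n, forall x, ~ T (code x n)).
  { apply NNPP. intros N. destruct (koenig T) as [x Hx].
    - intros L. apply NNPP. intros M. apply N. exists L. intros x Hx. eauto.
    - intros x L. rewrite !HT. intros [H1 H2]. split.
      + intros l Hl. apply H1. lia.
      + intros j l Hj Hl. apply H2; lia.
    - destruct (H x) as (n & L & E).
      + intros L. apply HT, Hx.
      + pose proof (Hx (max (1 + n) L)) as K. apply HT in K.
        apply (proj2 K n L); auto; lia. }
  (* Positions of length below [n] have codes below [2 ^ n], so [2 ^ n] letters of [S] contain all
     moves needed; the code of this word also exceeds [n], as the depth bound requires. *)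
  destruct Hn as [n Hn]. exists (code S (2 ^ n)). apply openb_spec. exists n.
  pose proof (code_gt S (2 ^ n)). pose proof (Nat.pow_gt_lin_r 2 n). split; [lia|].
  intros x Hx. apply NNPP. intros N. apply (Hn x), HT. split.
  - intros l Hl Tl. rewrite <- (Hx l Hl Tl).
    assert (code x l < 2 ^ n).
    { pose proof (code_bounds x l). pose proof (Nat.pow_le_mono_r 2 (Datatypes.S l) n). lia. }
    rewrite bit_code by lia. f_equal. lia.
  - intros j l Hj Hl E. apply N. exists j, l. auto.
Qed.

(** * Games reduce to closed choice and LPO *)

(* Instance number [j = 2 m + i] concerns player [i] and the outcome set [m]. *)
Definition event (q : Baire) (j t : nat) : bool :=
  if enum q (b2n (Nat.odd j)) (Nat.div2 j) 0 =? 1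
  then emptyb q (b2n (Nat.odd j)) (Nat.div2 j) t
  else openb q (b2n (Nat.odd j)) (Nat.div2 j) t.

Definition events (q : Baire) (y : nat) : nat :=
  b2n (exb (S y) (fun j => exb (S y) (fun t => (slot j t =? y) && event q j t))).

(** One closed set serves all instances: the letters at the positions [slot j e] form the strategy
    for instance [j]. The test on [slot j L] ensures that the word determines this strategy up to
    [L], and the test with [emptyb] is the truncation. *)
Definition badb (q : Baire) (N : nat) : bool :=
  exb (S N) (fun j => exb (S N) (fun L =>
    (enum q (b2n (Nat.odd j)) (Nat.div2 j) 0 =? 1) && (slot j L <? Nat.log2 N) &&
    negb (emptyb q (b2n (Nat.odd j)) (Nat.div2 j) L) &&
    violb q (b2n (Nat.odd j)) (Nat.div2 j) (2 ^ S j) (pred (2 ^ j)) N L)).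

Definition strategies_name (q : Baire) (N : nat) : nat := if badb q N then N else 0.
Definition strategies (q : Baire) (x : Cantor) : Prop := forall L, badb q (code x L) = false.

Lemma events_slot q j t : events q (slot j t) = b2n (event q j t).
Proof.
  unfold events. f_equal. apply eq_true_iff_eq. rewrite exb_spec.
  pose proof (slot_bounds j t). split.
  - intros (j' & _ & H'). apply exb_spec in H'. destruct H' as (t' & _ & H').
    apply andb_true_iff in H'. destruct H' as [E H']. apply Nat.eqb_eq, slot_inj in E.
    destruct E; subst; exact H'.
  - intros E. exists j. split; [lia|]. apply exb_spec. exists t. split; [lia|].
    rewrite Nat.eqb_refl. exact E.
Qed.

Lemma events_le q y : events q y <= 1.
Proof. unfold events. destruct (exb _ _); simpl; lia. Qed.

Lemma strategies_closed q : closed_named (strategies_name q) (strategies q).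
Proof.
  apply open_named_code. intros x. unfold strategies, strategies_name. split.
  - intros H. apply not_all_ex_not in H. destruct H as [L H].
    apply not_false_iff_true in H. exists (code x L), L. rewrite H. reflexivity.
  - intros (n & L & E) H. specialize (H L). pose proof (code_pos x L).
    destruct (badb q n) eqn:B; [|lia]. congruence.
Qed.

Lemma strategies_nonempty q : exists x, strategies q x.
Proof.
  set (f := fun j => proj1_sig (constructive_indefinite_description _
    (truncation_nonempty q (b2n (Nat.odd j)) (Nat.div2 j)))).
  assert (Hf : forall j L, emptyb q (b2n (Nat.odd j)) (Nat.div2 j) L = false ->
    ~ violates q (b2n (Nat.odd j)) (Nat.div2 j) (f j) L).
  { intros j. unfold f. destruct (constructive_indefinite_description _ _). auto. }
  (* Since [slot] is injective, the strategies chosen for the different instances fit into one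
     sequence. *)
  exists (fun y => if excluded_middle_informative (exists j e, y = slot j e /\ f j e = true)
    then true else false).
  set (x := fun y => _).
  assert (Hx : forall j e, x (slot j e) = f j e).
  { intros j e. unfold x. destruct (excluded_middle_informative _) as [(j' & e' & E & H)|N].
    - apply slot_inj in E. destruct E; subst; auto.
    - destruct (f j e) eqn:E; auto. exfalso. apply N. eauto. }
  intros M. apply not_true_iff_false. unfold badb. rewrite exb_spec.
  intros (j & _ & H). apply exb_spec in H. destruct H as (L & _ & H).
  rewrite !andb_true_iff, negb_true_iff, Nat.ltb_lt, log2_code in H.
  destruct H as [[[_ HL] HE] HV]. apply violb_spec in HV.
  apply (Hf j L HE). eapply violates_ext; [|exact HV].
  intros e He. cbv beta. fold (slot j e).
  assert (slot j e < slot j L).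
  { pose proof (S_slot j e). pose proof (S_slot j L). pose proof (Nat.pow_nonzero 2 j). nia. }
  rewrite bit_code by lia. apply Hx.
Qed.

Lemma strategies_slice q x j L : strategies q x ->
  enum q (b2n (Nat.odd j)) (Nat.div2 j) 0 = 1 ->
  emptyb q (b2n (Nat.odd j)) (Nat.div2 j) L = false ->
  ~ violates q (b2n (Nat.odd j)) (Nat.div2 j) (fun e => x (slot j e)) L.
Proof.
  (* [M] is the least length that passes the length test of [badb]. *)
  intros Hx HT HE HV. set (M := S (slot j L)). specialize (Hx M).
  apply not_true_iff_false in Hx. apply Hx. pose proof (code_gt x M).
  pose proof (slot_bounds j L). unfold badb. apply exb_spec. exists j. split; [lia|].
  apply exb_spec. exists L. split; [lia|].
  rewrite !andb_true_iff, negb_true_iff, Nat.ltb_lt, Nat.eqb_eq, log2_code.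
  repeat split; auto. apply violb_spec. eapply violates_ext; [|exact HV].
  intros e He. cbv beta. fold (slot j e).
  assert (slot j e < slot j L).
  { pose proof (S_slot j e). pose proof (S_slot j L). pose proof (Nat.pow_nonzero 2 j). nia. }
  rewrite bit_code by lia. reflexivity.
Qed.

Definition player (b : bool) : nat := if b then 0 else 1.

(** The principal upper set of [a] for player [i], as a binary number whose digits are appended from
    the highest outcome down. *)
Definition mask (q : Baire) (i a : nat) : nat :=
  nat_rect (fun _ => nat) 0 (fun t r => 2 * r + b2n (
    (a =? q (cpair 0 0) - 1 - t) ||
    negb (q (cpair (2 + i) (cpair a (q (cpair 0 0) - 1 - t))) =? 0))) (q (cpair 0 0)).

Definition answer (P : Baire) (j : nat) : nat := rgt (rgt (rgt P)) (slot j 0).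
(** Answer 1 means that the event never happens. For tag 1 the event is that the closed set cannot
    be forced; for tag 0 it is that a winning strategy has been found. In both cases the player can
    force the set iff the answer equals the tag. *)
Definition wonb (P : Baire) (i m : nat) : bool := answer P (2 * m + i) =? enum (lft P) i m 0.
Definition pick (P : Baire) : nat := findb (lft P (cpair 0 0)) (fun a =>
  wonb P 0 (mask (lft P) 0 a) && wonb P 1 (mask (lft P) 1 a)).

Definition mover (P : Baire) (y : nat) : nat := if lft P (cpair 1 y) =? 1 then 0 else 1.
Definition search_cond (P : Baire) (c i : nat) : nat :=
  b2n (negb ((enum (lft P) i (mask (lft P) i (pick P)) 0 =? 1) ||
             openb (lft P) i (mask (lft P) i (pick P)) c)).
Definition move (P : Baire) (c y : nat) : nat :=
  if enum (lft P) (mover P y) (mask (lft P) (mover P y) (pick P)) 0 =? 1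
  then lft (rgt P) (slot (2 * mask (lft P) (mover P y) (pick P) + mover P y) (S y))
  else b2n (bit c (S y)).

(** * Computability of the maps of the first reduction *)

Lemma R_slot n f g : R n f -> R n g -> R n (fun p xs => slot (f p xs) (g p xs)).
Proof. intros. unfold slot. rc. Qed.
Lemma R_pre n f g : R n f -> R n g -> R n (fun p xs => pre (f p xs) (g p xs)).
Proof. intros. unfold pre. rc. Qed.
Lemma R_bit n f g : R n f -> R n g -> R n (fun p xs => b2n (bit (f p xs) (g p xs))).
Proof. intros. unfold bit. rc. apply R_pre; rc. Qed.
Lemma R_enum A : computes A -> Closed3 (fun p => enum (A p)).
Proof. intros HA. apply closed3. unfold enum. rc. Qed.

Ltac rhook ::= lazymatch goal with
  | |- R _ (fun p xs => slot _ _) => apply R_slot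
  | |- R _ (fun p xs => pre _ _) => apply R_pre
  | |- R _ (fun p xs => b2n (bit _ _)) => apply R_bit
  | HA : computes ?A |- R _ (fun p xs => enum (?A p) _ _ _) => apply (R_enum A HA)
  | HA : computes ?A |- R _ (fun p xs => en (?A p) _ _ _) => unfold en
  | HA : computes ?A |- R _ (fun p xs => b2n (turnb (?A p) _ _)) => unfold turnb
  | HA : computes ?A |- R _ (fun p xs => ?A p _) => apply HA
  end.

Lemma R_consb A : computes A ->
  Closed5 (fun p i a b N d => b2n (consb (A p) i a b N d)).
Proof. intros HA. apply closed5. unfold consb. rc. Qed.
Lemma R_violb A : computes A ->
  Closed6 (fun p i m a b N L => b2n (violb (A p) i m a b N L)).
Proof. intros HA. apply closed6. unfold violb. rc. apply (R_consb A HA); rc. Qed.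
Lemma R_emptyb A : computes A ->
  Closed3 (fun p i m L => b2n (emptyb (A p) i m L)).
Proof. intros HA. apply closed3. unfold emptyb. rc. apply (R_violb A HA); rc. Qed.
Lemma R_openb A : computes A ->
  Closed3 (fun p i m c => b2n (openb (A p) i m c)).
Proof. intros HA. apply closed3. unfold openb. rc. apply (R_consb A HA); rc. Qed.
Lemma R_event A : computes A -> Closed2 (fun p j t => b2n (event (A p) j t)).
Proof.
  intros HA. apply closed2. unfold event.
  rc; [apply (R_emptyb A HA)|apply (R_openb A HA)]; rc.
Qed.
Lemma R_events A : computes A -> computes (fun p => events (A p)).
Proof. intros HA. apply closed1. unfold events. rc. apply (R_event A HA); rc. Qed.
Lemma R_strategies_name A : computes A -> computes (fun p => strategies_name (A p)).
Proof.
  intros HA. apply closed1. unfold strategies_name, badb.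
  rc; [apply (R_emptyb A HA)|apply (R_violb A HA)]; rc.
Qed.
Lemma computes_join A B : computes A -> computes B -> computes (fun p => join (A p) (B p)).
Proof. intros HA HB. apply closed1. unfold join. rc. Qed.
Lemma R_mask A : computes A -> Closed2 (fun p => mask (A p)).
Proof. intros HA. apply closed2. unfold mask. rc. Qed.

Lemma computes_lft_id : computes lft.
Proof. exact (computes_lft _ computes_id). Qed.

Lemma R_answer : Closed1 answer.
Proof.
  apply closed1. unfold answer.
  apply (computes_rgt _ (computes_rgt _ (computes_rgt _ computes_id))). apply R_slot; rc.
Qed.

Ltac rhook ::= lazymatch goal with
  | |- R _ (fun p xs => slot _ _) => apply R_slot
  | |- R _ (fun p xs => b2n (bit _ _)) => apply R_bit
  | |- R _ (fun p xs => enum (lft p) _ _ _) => apply (R_enum lft computes_lft_id)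
  | |- R _ (fun p xs => mask (lft p) _ _) => apply (R_mask lft computes_lft_id)
  | |- R _ (fun p xs => b2n (openb (lft p) _ _ _)) => apply (R_openb lft computes_lft_id)
  | |- R _ (fun p xs => lft (rgt p) _) =>
      apply (computes_lft _ (computes_rgt _ computes_id))
  | |- R _ (fun p xs => lft p _) => apply computes_lft_id
  | |- R _ (fun p xs => answer p _) => apply R_answer
  end.

Lemma R_pick n : R n (fun p _ => pick p).
Proof. unfold pick, wonb. rc. Qed.

Lemma R_mover : Closed1 mover.
Proof. apply closed1. unfold mover. rc. Qed.

Lemma R_search_cond : Closed2 search_cond.
Proof. apply closed2. unfold search_cond. rc; apply R_pick. Qed.

Lemma R_move : Closed2 move.
Proof. apply closed2. unfold move. rc; first [apply R_pick | apply R_mover; rc]. Qed.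

(** The index [2 m + i] with [m < 2 ^ nout] and two players accounts for [2 ^ S nout] instances of
    LPO. *)
Definition instance_name (q : Baire) : Baire :=
  join (strategies_name q) (join (fun _ => 2 ^ S (q (cpair 0 0))) (events q)).

Lemma instance_name_computes : computes instance_name.
Proof.
  apply computes_join; [apply (R_strategies_name _ computes_id)|].
  apply (computes_join (fun q _ => 2 ^ S (q (cpair 0 0))) events);
    [|apply (R_events _ computes_id)].
  apply closed1. rc.
Qed.

Lemma testbit_double r b n : Nat.testbit (2 * r + b2n b) n =
  match n with 0 => b | S n => Nat.testbit r n end.
Proof.
  destruct n; destruct b; unfold b2n; rewrite ?Nat.add_0_r;
    first [apply Nat.testbit_odd_0 | apply Nat.testbit_even_0
          |apply Nat.testbit_odd_succ; lia | apply Nat.testbit_even_succ; lia].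
Qed.

Lemma bits_rect (k : nat) (f : nat -> bool) :
  let M := nat_rect (fun _ => nat) 0 (fun t r => 2 * r + b2n (f (k - 1 - t))) k in
  M < 2 ^ k /\ forall b, b < k -> Nat.testbit M b = f b.
Proof.
  assert (H : forall t, t <= k ->
    let M := nat_rect (fun _ => nat) 0 (fun t r => 2 * r + b2n (f (k - 1 - t))) t in
    M < 2 ^ t /\ forall b, b < t -> Nat.testbit M b = f (k - t + b)).
  { induction t as [|t IH]; intros Ht; [simpl; split; [lia|intros; lia]|].
    destruct IH as [H1 H2]; [lia|]. cbv zeta. rewrite nat_rect_S.
    set (M := nat_rect _ _ _ t) in *. split.
    - rewrite Nat.pow_succ_r'. destruct (f (k - 1 - t)); simpl; lia.
    - intros b Hb. rewrite testbit_double. destruct b as [|b].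
      + f_equal. lia.
      + rewrite H2 by lia. f_equal. lia. }
  destruct (H k (le_n k)) as [H1 H2]. split; auto.
  intros b Hb. rewrite H2 by auto. f_equal. lia.
Qed.

(** * Winning strategies and equilibria of a named game *)

Section NamedGame.
Variables (p : Baire) (G : game).
Hypothesis Hp : game_named OA_named p G.

Lemma pref_linear b : strict_linear (nout G) (pref_of G b).
Proof.
  destruct Hp as [[H1 [H2 H3]] _]. destruct b; [repeat split; auto|].
  repeat split; simpl.
  - exact H1.
  - intros a b c Ha Hb Hc Hab Hbc. apply (H2 c b a); auto.
  - intros a b Ha Hb N. destruct (H3 a b); auto.
Qed.

Lemma val_lt x : val G x < nout G.
Proof. apply Hp. Qed.

Lemma turnb_player b d : 1 <= d -> turnb p (player b) d = true <-> turn G (word d) = b.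
Proof.
  intros Hd. destruct Hp as (_ & _ & _ & H & _). unfold turnb. rewrite Nat.eqb_eq.
  specialize (H (pred d)). unfold comp in H. rewrite H. unfold word.
  destruct (turn G _), b; simpl; split; congruence.
Qed.

Lemma nout_name : p (cpair 0 0) = nout G.
Proof. apply Hp. Qed.

Lemma mask_spec b a : a < nout G -> mask p (player b) a < 2 ^ nout G /\
  forall c, c < nout G -> Nat.testbit (mask p (player b) a) c = true <->
    a = c \/ pref_of G b a c = true.
Proof.
  intros Ha. unfold mask. rewrite nout_name.
  destruct (bits_rect (nout G) (fun c => (a =? c) ||
    negb (p (cpair (2 + player b) (cpair a c)) =? 0))) as [H1 H2].
  split; [exact H1|]. intros c Hc. rewrite H2 by exact Hc.
  rewrite orb_true_iff, Nat.eqb_eq, negb_true_iff, Nat.eqb_neq.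
  destruct Hp as (_ & _ & _ & _ & P2 & P3 & _). unfold comp in *.
  destruct b; simpl player; simpl Nat.add;
    [rewrite P2 by auto|rewrite P3 by auto];
    destruct (pref_of G _ a c); simpl; split; intros [?|?]; auto; congruence.
Qed.

Lemma mask_upset b a : a < nout G -> upset (nout G) (pref_of G b) (mask p (player b) a).
Proof.
  intros Ha c d Hc Hd T L. destruct (mask_spec b a Ha) as [_ M].
  apply M in T; auto. apply M; auto. right.
  destruct (pref_linear b) as (_ & tr & _). destruct T as [<-|T]; auto.
  apply (tr a c d); auto.
Qed.

Lemma preimage_name b m : m < 2 ^ nout G -> upset (nout G) (pref_of G b) m ->
  (enum p (player b) m 0 = 0 /\
   forall x, preimage G m x <-> exists n L, en p (player b) m n = code x L) \/
  (enum p (player b) m 0 = 1 /\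
   forall x, ~ preimage G m x <-> exists n L, en p (player b) m n = code x L).
Proof.
  intros Hm Hu. destruct Hp as (_ & _ & _ & _ & _ & _ & H4 & H5).
  assert (H : OA_named (comp m (comp (4 + player b) p)) (preimage G m))
    by (destruct b; auto).
  destruct H as [[T H]|[T H]]; [left|right]; split; auto;
    exact (proj1 (open_named_code _ _) H).
Qed.

Definition wins (b : bool) (m : nat) (S : nat -> bool) : Prop :=
  forall x, (forall L, follows p (player b) S x L) -> preimage G m x.

Lemma event_index b m : b2n (Nat.odd (2 * m + player b)) = player b /\
  Nat.div2 (2 * m + player b) = m.
Proof.
  destruct b; simpl player.
  - rewrite Nat.add_0_r, Nat.div2_double, <- Nat.negb_even, even_double. auto.
  - rewrite <- Nat.negb_even, even_double_1, div2_double_1. auto.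
Qed.

Lemma wins_iff_event b m a : m < 2 ^ nout G -> upset (nout G) (pref_of G b) m ->
  LPO_answer a (fun t => events p (slot (2 * m + player b) t)) ->
  (exists S, wins b m S) <-> a = enum p (player b) m 0.
Proof.
  intros Hm Hu Ha.
  assert (Ha' : a = 1 /\ (forall t, event p (2 * m + player b) t = false) \/
    a = 0 /\ exists t, event p (2 * m + player b) t = true).
  { destruct Ha as [[-> H]|[-> [t H]]]; [left|right]; split; auto.
    - intros t. specialize (H t). cbv beta in H. rewrite events_slot in H.
      destruct (event p _ t); [discriminate|reflexivity].
    - exists t. rewrite events_slot in H. destruct (event p _ t); [reflexivity|].
      destruct (H eq_refl). }
  clear Ha. unfold event in Ha'. destruct (event_index b m) as [E1 E2].
  rewrite E1, E2 in Ha'.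
  destruct (preimage_name b m Hm Hu) as [[T P]|[T P]]; rewrite T in *; simpl in Ha'.
  - split.
    + intros [S HS]. destruct Ha' as [[_ N]|[-> _]]; [|reflexivity]. exfalso.
      destruct (open_complete p (player b) m S) as [c Hc].
      * intros x Hx. apply P, HS, Hx.
      * rewrite N in Hc. discriminate.
    + intros ->. destruct Ha' as [[H _]|[_ [c Hc]]]; [discriminate|].
      exists (bit c). intros x Hx. apply P. apply (open_sound _ _ _ c); auto.
  - split.
    + intros [S HS]. destruct Ha' as [[-> _]|[_ [L HL]]]; [reflexivity|]. exfalso.
      rewrite emptyb_spec in HL.
      apply (closed_complete p (player b) m S) with L; [|apply HL].
      intros x Hx E. apply P in E. apply E, HS, Hx.
    + intros ->. destruct Ha' as [[_ N]|[H _]]; [|discriminate].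
      destruct (truncation_nonempty p (player b) m) as [S HS].
      exists S. intros x Hx. apply NNPP. intros E. apply P in E. revert E.
      apply closed_sound with S; auto.
Qed.

(** With [play_follows]: the sequences consistent with the strategy of [b] are exactly the plays
    against deviations of the opponent, who can copy [x] by looking only at the length of the
    history. *)
Lemma deviation_play b (s : strategy) x :
  (forall L, follows p (player b) (fun d => s (word d)) x L) ->
  exists s', deviation G (negb b) s s' /\ play s' = x.
Proof.
  intros H. exists (fun w => if Bool.eqb (turn G w) b then s w else x (length w)). split.
  - intros w Hw. destruct (turn G w), b; simpl in *; congruence.
  - apply play_unique. intros l. rewrite length_word_code.
    destruct (Bool.eqb (turn G (word (code x l))) b) eqn:E; [|reflexivity].
    apply eqb_prop in E. symmetry. apply (H (S l)); [lia|].
    apply turnb_player; auto using code_pos.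
Qed.

Lemma play_follows b (s s' : strategy) : deviation G (negb b) s s' ->
  forall L, follows p (player b) (fun d => s (word d)) (play s') L.
Proof.
  intros H L l Hl T. apply turnb_player in T; [|apply code_pos].
  rewrite (play_code s' l). symmetry. apply H. rewrite T. destruct b; discriminate.
Qed.

Lemma pref_of_negb b a c : pref_of G (negb b) a c = pref_of G b c a.
Proof. destruct b; reflexivity. Qed.

(** The preferences are inverse to each other, so an opponent who cannot gain by deviating cannot
    make [b] worse off either. *)
Lemma nash_wins s b : nash G s ->
  wins b (mask p (player b) (val G (play s))) (fun d => s (word d)).
Proof.
  intros H x Hx. destruct (deviation_play b s x Hx) as (s' & Hd & <-).
  specialize (H _ _ Hd). rewrite pref_of_negb in H.
  unfold preimage. apply mask_spec; try apply val_lt.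
  destruct (Nat.eq_dec (val G (play s)) (val G (play s'))) as [|N]; auto.
  destruct (pref_linear b) as (_ & _ & tot).
  destruct (tot _ _ (val_lt _) (val_lt _) N) as [K|K]; auto. congruence.
Qed.

(** Both guarantees apply to the play of [s] itself, so its outcome is [a] by antisymmetry. A
    deviation of one player is then bounded by the guarantee of the other. *)
Lemma wins_nash s a : a < nout G ->
  (forall b, wins b (mask p (player b) a) (fun d => s (word d))) -> nash G s.
Proof.
  intros Ha H.
  assert (Hv : forall b s', deviation G (negb b) s s' ->
    a = val G (play s') \/ pref_of G b a (val G (play s')) = true).
  { intros b s' Hd. apply mask_spec; auto using val_lt. apply H, play_follows, Hd. }
  assert (Hval : a = val G (play s)).
  { assert (D : forall i, deviation G i s s) by (intros i w _; reflexivity).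
    destruct (Hv true s (D _)) as [|V1]; auto. destruct (Hv false s (D _)) as [|V2]; auto.
    exfalso. destruct (pref_linear true) as (irr & tr & _).
    assert (K := tr a (val G (play s)) a Ha (val_lt _) Ha V1 V2).
    rewrite irr in K by auto. discriminate. }
  intros i s' Hd. rewrite <- Hval. rewrite <- (negb_involutive i) in Hd.
  destruct (pref_linear i) as (irr & tr & _).
  destruct (Hv _ _ Hd) as [<-|V]; [apply irr; auto|].
  rewrite pref_of_negb in V. apply not_true_iff_false. intros K.
  assert (K' := tr a _ a Ha (val_lt _) Ha K V). rewrite irr in K' by auto. discriminate.
Qed.

End NamedGame.

Lemma star_rel_inv X Y (f : problem X Y) u v : star_rel f u v ->
  exists ys, v = existT _ (projT1 u) ys /\ pow_prob f (projT1 u) (projT2 u) ys.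
Proof. intros [n xs ys H]. exists ys. auto. Qed.

Lemma NE_le_C_LPO : W_le (NE_ap OA_named) (prod_prob C_Cantor (star LPO)).
Proof.
  destruct (computable_search search_cond move mover R_search_cond R_move R_mover)
    as (K & HK & Ksearch).
  exists K, (fun p => Some (instance_name p)). split; [exact HK|].
  split; [apply computable_total, instance_name_computes|].
  intros F HF p G Hp [s0 Hs0]. change (game_named OA_named p G) in Hp.
  change (nash G s0) in Hs0. change game in G.
  set (n := 2 ^ S (nout G)).
  destruct (pow_cantor_named n (events p) (events_le p)) as [xs Hxs].
  destruct (HF (instance_name p) (strategies p, existT _ n xs)) as (r & Er & y & Hy & Hr).
  { unfold instance_name. split; simpl; rewrite ?lft_join, ?rgt_join.
    - apply strategies_closed.
    - split; [unfold n; rewrite (nout_name _ _ Hp); reflexivity|exact Hxs]. }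
  { destruct (strategies_nonempty p) as [x Hx]. destruct (pow_LPO_total n xs) as [ys Hys].
    exists (x, existT _ n ys). split; [exact Hx|apply (star_intro LPO n xs ys Hys)]. }
  rewrite Er. destruct y as [x u]. destruct Hy as [Hx Hu]. destruct Hr as [Hrx Hru].
  simpl in Hx, Hu, Hrx, Hru. apply star_rel_inv in Hu. destruct Hu as (ys & -> & Hys).
  destruct Hru as [_ Hru]. simpl in Hys, Hru.
  set (P := join p r) in *.
  assert (EP : lft P = p) by apply lft_join. assert (ER : rgt P = r) by apply rgt_join.
  assert (Hans : forall j, j < n -> LPO_answer (answer P j) (fun t => events p (slot j t))).
  { intros j Hj. unfold answer. rewrite ER.
    apply (pow_LPO_answers n (events p) (rgt (rgt r)) xs Hxs); [exists ys; auto|exact Hj]. }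
  assert (Hwon : forall b a, a < nout G ->
    (exists S, wins p G b (mask p (player b) a) S) <->
    wonb P (player b) (mask p (player b) a) = true).
  { intros b a Ha. destruct (mask_spec p G Hp b a Ha) as [Hm _].
    unfold wonb. rewrite Nat.eqb_eq, EP. apply (wins_iff_event p G Hp); auto.
    - apply mask_upset; auto.
    - apply Hans. unfold n. rewrite Nat.pow_succ_r'.
      assert (player b < 2) by (destruct b; simpl; lia). lia. }
  destruct (findb_spec (nout G) (fun a =>
    wonb P 0 (mask p 0 a) && wonb P 1 (mask p 1 a))) as [Ha Hpick].
  (* The outcome of the equilibrium assumed to exist passes both tests; the assumption enters only
     here. *)
  { exists (val G (play s0)). split; [apply (val_lt p G Hp)|].
    apply andb_true_iff. split; [apply (Hwon true)|apply (Hwon false)];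
      try apply (val_lt p G Hp); eexists; apply (nash_wins p G Hp _ _ Hs0). }
  assert (Epick : pick P = findb (nout G) (fun a =>
    wonb P 0 (mask p 0 a) && wonb P 1 (mask p 1 a))).
  { unfold pick. rewrite EP, (nout_name p G Hp). reflexivity. }
  rewrite <- Epick in Ha, Hpick. clear Epick.
  assert (Hwins : forall b, exists S, wins p G b (mask p (player b) (pick P)) S).
  { intros b. apply andb_true_iff in Hpick. apply (Hwon b (pick P) Ha). destruct b; apply Hpick. }
  assert (Hmover : forall d, 1 <= d -> mover P (pred d) = player (turn G (word d))).
  { intros d Hd. unfold mover. rewrite EP.
    destruct Hp as (_ & _ & _ & H & _). specialize (H (pred d)). unfold comp in H.
    rewrite H. unfold word. destruct (turn G _); reflexivity. }
  assert (Hname : forall b, _) by (intros b; exact (preimage_name p G Hp b _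
    (proj1 (mask_spec p G Hp b (pick P) Ha)) (mask_upset p G Hp b (pick P) Ha))).
  destruct (Ksearch P) as (q & C & EK & HC).
  { intros y. change y with (pred (S y)). rewrite Hmover by lia.
    set (b := turn G (word (S y))). unfold search_cond. rewrite EP.
    destruct (Hname b) as [[T N]|[T N]]; rewrite T; simpl.
    - destruct (Hwins b) as [S HS].
      destruct (open_complete p (player b) (mask p (player b) (pick P)) S) as [c Hc].
      + intros x' Hx'. apply N, HS, Hx'.
      + exists c. rewrite Hc. reflexivity.
    - exists 0. reflexivity. }
  exists q. split; [exact EK|].
  set (m := fun b => mask p (player b) (pick P)) in *.
  set (Sb := fun b d => if enum p (player b) (m b) 0 =? 1
    then x (slot (2 * m b + player b) d) else bit (C (player b)) d).
  assert (Hq : forall d, 1 <= d ->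
    search_cond P (C (player (turn G (word d)))) (player (turn G (word d))) = 0 /\
    q (pred d) = b2n (Sb (turn G (word d)) d)).
  { intros d Hd. specialize (HC (pred d)). rewrite Hmover in HC by exact Hd.
    destruct HC as [H1 H2]. split; [exact H1|]. rewrite H2.
    unfold move, Sb. rewrite Hmover, EP, ER by exact Hd. fold (m (turn G (word d))).
    rewrite Nat.succ_pred by lia.
    destruct (enum p _ _ 0 =? 1); [apply Hrx|reflexivity]. }
  exists (fun w => Sb (turn G w) (wcode w)). split.
  - apply (wins_nash p G Hp _ (pick P) Ha). intros b y Hy. fold (m b).
    assert (Hy' : forall L, follows p (player b) (Sb b) y L).
    { intros L l Hl T. rewrite <- (Hy L l Hl T). apply (turnb_player p G Hp) in T;
        auto using code_pos.
      rewrite T, wcode_word by apply code_pos. reflexivity. }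
    destruct (Hname b) as [[T N]|[T N]]; fold (m b) in T, N.
    (* The search is known to succeed only for a player who moves somewhere. A sequence on which [b]
       never moves is consistent with every strategy, in particular with a winning one. *)
    + destruct (classic (exists l, turn G (word (code y l)) = b)) as [[l E]|E].
      * destruct (Hq (code y l) (code_pos y l)) as [H _]. rewrite E in H.
        unfold search_cond in H. rewrite EP in H. fold (m b) in H. rewrite T in H. simpl in H.
        destruct (openb p (player b) (m b) (C (player b))) eqn:O; [|discriminate].
        apply N. apply (open_sound _ _ _ _ O). intros L k Hk Tk.
        rewrite <- (Hy' L k Hk Tk). unfold Sb. rewrite T. reflexivity.
      * destruct (Hwins b) as [S HS]. apply HS. intros L k _ Tk. exfalso. apply E.
        exists k. apply (turnb_player p G Hp); auto using code_pos.
    + apply NNPP. intros Ny. apply N in Ny. revert Ny.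
      apply closed_sound with (Sb b); [|exact Hy'].
      destruct (event_index b (m b)) as [E1 E2].
      intros L V.
      (* The set can be forced, so no stage is empty and the truncation does not take effect. *)
      assert (Hne : emptyb p (player b) (m b) L = false).
      { apply emptyb_false. destruct (Hwins b) as [S HS]. exists S.
        apply closed_complete. intros z Hz Nz. apply N in Nz. apply Nz, HS, Hz. }
      apply (strategies_slice p x (2 * m b + player b) L Hx); rewrite ?E1, ?E2; auto.
      eapply violates_ext; [|exact V]. intros e _. unfold Sb. rewrite T. reflexivity.
  - intros k. simpl. destruct (Hq (S k) ltac:(lia)) as [_ E]. simpl pred in E. rewrite E.
    change (word_of_nat k) with (word (S k)). rewrite wcode_word by lia. reflexivity.
Qed.

(** * Closed choice and LPO reduce to games *)

Definition count (q : Baire) : nat := lft (rgt q) 0.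
Definition instances (q : Baire) : Baire := rgt (rgt q).
Definition tail (n : nat) (x : Cantor) : Cantor := fun k => x (n + k).

(* The first [count q] moves claim, with letter 0, that an LPO instance vanishes; the
   later moves claim to describe an element of the given closed set. *)
Definition falsified (q : Baire) (x : Cantor) : Prop :=
  (exists j, j < count q /\ x j = false /\ exists t, instances q (slot j t) <> 0) \/
  (exists t L, lft q t = code (tail (count q) x) L).

Definition falsb (q : Baire) (N : nat) : bool :=
  exb (count q) (fun j => negb (bit N j) &&
    exb (Nat.log2 N) (fun t => negb (instances q (slot j t) =? 0))) ||
  exb (Nat.log2 N) (fun t => (1 <=? lft q t) &&
    (count q + Nat.log2 (lft q t) <=? Nat.log2 N) &&
    allb (Nat.log2 (lft q t)) (fun i => Bool.eqb (bit (lft q t) i) (bit N (count q + i)))).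

(** The first [n = count q] letters have a code from [2 ^ n] to [2 ^ S n - 1], so the payoffs run
    from 1 to [2 ^ n], and 0 is left for falsified plays. Changing a letter to 0, one more claim,
    raises the payoff. *)
Definition claim_game (q : Baire) : game := {|
  nout := S (2 ^ count q);
  turn := fun _ => true;
  pref := Nat.ltb;
  val := fun x => if excluded_middle_informative (falsified q x) then 0
                  else 2 ^ S (count q) - code x (count q) |}.

(** With [s = true] this enumerates the complement of an upper set of player 1, with [s = false] an
    upper set of player 2. Both are downward closed in the order of numbers, so a word whose claims
    give a payoff in the set may be listed at once: later falsification moves the outcome to 0,
    still in the set. *)
Definition nameb (q : Baire) (s : bool) (m N : nat) : bool :=
  (1 <=? N) && (count q <=? Nat.log2 N) &&
  (xorb s (Nat.testbit m (2 ^ S (count q) - pre N (count q))) ||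
   xorb s (Nat.testbit m 0) && falsb q N).

Definition game_name (q : Baire) (y : nat) : nat :=
  if fstp y =? 0 then S (2 ^ count q)
  else if fstp y =? 1 then 1
  else if fstp y =? 2 then b2n (fstp (sndp y) <? sndp (sndp y))
  else if fstp y =? 3 then b2n (sndp (sndp y) <? fstp (sndp y))
  else if sndp (sndp y) =? 0 then b2n (fstp y =? 4)
  else if nameb q (fstp y =? 4) (fstp (sndp y)) (pred (sndp (sndp y)))
  then pred (sndp (sndp y)) else 0.

Definition play_at (r : Baire) (L : nat) : nat :=
  r (pred (nat_rect (fun _ => nat) 1 (fun _ c => 2 * c + r (pred c)) L)).

(** The answer of instance [j] stands at [slot j 0], which is [2 ^ j - 1], hence [Nat.log2 (S y)].
    Letter 0 claims that the sequence vanishes, where LPO answers 1, hence the subtraction. *)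
Definition read_play (P : Baire) : Baire :=
  join (fun k => play_at (rgt P) (count (lft P) + k))
    (join (fun _ => count (lft P))
      (fun y => 1 - play_at (rgt P) (Nat.log2 (S y)))).

(** * Computability of the maps of the second reduction *)

Lemma R_fstp n f : R n f -> R n (fun p xs => fstp (f p xs)).
Proof. apply (closed1 (fun _ => fstp)). unfold fstp. rc. Qed.
Lemma R_sndp n f : R n f -> R n (fun p xs => sndp (f p xs)).
Proof. apply (closed1 (fun _ => sndp)). unfold sndp. rc. Qed.

Lemma computes_instances : computes instances.
Proof. exact (computes_rgt _ (computes_rgt _ computes_id)). Qed.

Lemma R_count A n : computes A -> R n (fun p _ => count (A p)).
Proof.
  intros HA. unfold count. apply (computes_lft _ (computes_rgt _ HA)). apply R_const.
Qed.

Ltac rhook ::= lazymatch goal with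
  | |- R _ (fun p xs => slot _ _) => apply R_slot
  | |- R _ (fun p xs => pre _ _) => apply R_pre
  | |- R _ (fun p xs => b2n (bit _ _)) => apply R_bit
  | |- R _ (fun p xs => fstp _) => apply R_fstp
  | |- R _ (fun p xs => sndp _) => apply R_sndp
  | |- R _ (fun p xs => count p) => apply (R_count _ _ computes_id)
  | |- R _ (fun p xs => count (lft p)) => apply (R_count lft _ computes_lft_id)
  | |- R _ (fun p xs => instances p _) => apply computes_instances
  | |- R _ (fun p xs => lft p _) => apply computes_lft_id
  end.

Lemma R_falsb n f : R n f -> R n (fun p xs => b2n (falsb p (f p xs))).
Proof. apply (closed1 (fun p N => b2n (falsb p N))). unfold falsb. rc. Qed.

Lemma R_game_name : computes game_name.
Proof. apply closed1. unfold game_name, nameb. rc; apply R_falsb; rc. Qed.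

Lemma R_play_at : Closed1 (fun p => play_at (rgt p)).
Proof.
  apply closed1. unfold play_at. apply (computes_rgt _ computes_id). rc.
  apply (computes_rgt _ computes_id). rc.
Qed.

Lemma R_read_play : computes read_play.
Proof.
  apply (computes_join (fun P k => play_at (rgt P) (count (lft P) + k))).
  - apply closed1. apply R_play_at. rc.
  - apply (computes_join (fun P _ => count (lft P))
      (fun P y => 1 - play_at (rgt P) (Nat.log2 (S y)))).
    + apply closed1. rc.
    + apply closed1. rc. apply R_play_at. rc.
Qed.

Lemma falsb_sound q x M : count q <= M -> falsb q (code x M) = true -> falsified q x.
Proof.
  intros HM. unfold falsb. rewrite orb_true_iff, !exb_spec, log2_code.
  intros [(j & Hj & H)|(t & _ & H)].
  - left. exists j. rewrite andb_true_iff, negb_true_iff, bit_code, exb_spec in H by lia.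
    destruct H as [H (t & _ & Ht)]. repeat split; auto. exists t.
    apply negb_true_iff, Nat.eqb_neq in Ht. exact Ht.
  - right. rewrite !andb_true_iff, !Nat.leb_le, allb_spec in H. destruct H as [[H1 H2] H3].
    destruct (code_surj _ H1) as (y & L & E). exists t, L.
    rewrite E, log2_code in *. apply code_ext. intros l Hl. specialize (H3 l Hl).
    apply eqb_prop in H3. rewrite !bit_code in H3 by lia. exact H3.
Qed.

Lemma falsb_complete q x : falsified q x -> exists M, count q <= M /\ falsb q (code x M) = true.
Proof.
  intros [(j & Hj & Hx & t & Ht)|(t & L & E)].
  - exists (count q + S t). split; [lia|]. unfold falsb. apply orb_true_iff. left.
    rewrite log2_code, exb_spec. exists j. split; auto.
    rewrite bit_code, Hx by lia. apply exb_spec. exists t. split; [lia|].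
    apply negb_true_iff, Nat.eqb_neq, Ht.
  - exists (count q + L + S t). split; [lia|]. unfold falsb. apply orb_true_iff. right.
    rewrite log2_code, exb_spec. exists t. split; [lia|].
    rewrite E, log2_code, !andb_true_iff, !Nat.leb_le, allb_spec.
    repeat split; [apply code_pos|lia|]. intros i Hi.
    rewrite !bit_code by lia. apply eqb_reflx.
Qed.

Lemma payoff_bounds x n : 1 <= 2 ^ S n - code x n <= 2 ^ n.
Proof. pose proof (code_bounds x n) as H. rewrite Nat.pow_succ_r' in *. lia. Qed.

Lemma nameb_spec q s m :
  (forall c, 1 <= c <= 2 ^ count q -> xorb s (Nat.testbit m c) = true ->
    xorb s (Nat.testbit m 0) = true) ->
  forall x, xorb s (Nat.testbit m (val (claim_game q) x)) = true <->
    exists N L, (if nameb q s m N then N else 0) = code x L.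
Proof.
  intros Hm x. simpl val. split.
  - intros H.
    assert (HM : exists M, count q <= M /\ nameb q s m (code x M) = true).
    { destruct (excluded_middle_informative _) as [F|F].
      - destruct (falsb_complete _ _ F) as (M & HM & E). exists M. split; auto.
        unfold nameb. rewrite !andb_true_iff, !Nat.leb_le, log2_code, H, E.
        repeat split; auto using code_pos. apply orb_true_r.
      - exists (count q). split; auto.
        unfold nameb. rewrite !andb_true_iff, !Nat.leb_le, log2_code, pre_code by auto.
        change (2 ^ S (count q)) with (2 ^ count q + (2 ^ count q + 0)). rewrite H.
        repeat split; auto using code_pos. }
    destruct HM as (M & _ & E). exists (code x M), M. rewrite E. reflexivity.
  - intros (N & L & H). pose proof (code_pos x L).
    destruct (nameb q s m N) eqn:E; [|lia]. subst N. unfold nameb in E.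
    rewrite !andb_true_iff, !Nat.leb_le, log2_code in E. destruct E as [[_ HL] E].
    rewrite pre_code in E by auto. apply orb_true_iff in E.
    pose proof (payoff_bounds x (count q)) as B.
    change (2 ^ count q + (2 ^ count q + 0)) with (2 ^ S (count q)).
    destruct (excluded_middle_informative _) as [F|F].
    + destruct E as [E|E]; [exact (Hm _ B E)|]. apply andb_true_iff in E. apply E.
    + destruct E as [E|E]; [exact E|]. apply andb_true_iff in E. exfalso. apply F.
      eapply falsb_sound; [exact HL|apply E].
Qed.

Lemma game_name_set q j m t : 4 <= j ->
  comp m (comp j (game_name q)) t = if t =? 0 then b2n (j =? 4)
    else if nameb q (j =? 4) m (pred t) then pred t else 0.
Proof.
  intros Hj. unfold comp, game_name. rewrite !fstp_cpair, !sndp_cpair, !fstp_cpair.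
  destruct j as [|[|[|[|j]]]]; try lia. reflexivity.
Qed.

Lemma game_name_named q : game_named OA_named (game_name q) (claim_game q).
Proof.
  assert (Hval : forall x, val (claim_game q) x < nout (claim_game q)).
  { intros x. simpl val. simpl nout. pose proof (payoff_bounds x (count q)) as B.
    simpl in B. destruct (excluded_middle_informative _); lia. }
  split; [|split; [exact Hval|split; [|split; [|split; [|split; [|split]]]]]].
  - repeat split; simpl; intros; rewrite ?Nat.ltb_lt, ?Nat.ltb_irrefl in *; lia.
  - unfold comp, game_name. rewrite fstp_cpair. reflexivity.
  - intros k. unfold comp, game_name. rewrite fstp_cpair. reflexivity.
  - intros a b _ _. unfold comp, game_name.
    rewrite fstp_cpair, sndp_cpair, fstp_cpair, sndp_cpair. reflexivity.
  - intros a b _ _. unfold comp, game_name.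
    rewrite fstp_cpair, sndp_cpair, fstp_cpair, sndp_cpair. reflexivity.
  - intros m _ Hu. right. split; [rewrite game_name_set by lia; reflexivity|].
    apply open_named_code. intros x.
    transitivity (xorb true (Nat.testbit m (val (claim_game q) x)) = true).
    { unfold preimage. destruct (Nat.testbit m _); simpl; split; congruence. }
    rewrite (nameb_spec q true m).
    + split; intros (N & L & E).
      * exists N, L. unfold shift. rewrite game_name_set by lia. exact E.
      * exists N, L. unfold shift in E. rewrite game_name_set in E by lia. exact E.
    + intros c Hc T. rewrite xorb_true_l, negb_true_iff in *.
      apply not_true_iff_false. intros K. rewrite (Hu 0 c) in T;
        simpl; auto; try lia; try discriminate T.
      apply Nat.ltb_lt. lia.
  - intros m _ Hu. left. split; [rewrite game_name_set by lia; reflexivity|].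
    apply open_named_code. intros x.
    change (preimage (claim_game q) m x)
      with (Nat.testbit m (val (claim_game q) x) = true).
    rewrite <- (xorb_false_l (Nat.testbit m (val (claim_game q) x))), (nameb_spec q false m).
    + split; intros (N & L & E).
      * exists N, L. unfold shift. rewrite game_name_set by lia. exact E.
      * exists N, L. unfold shift in E. rewrite game_name_set in E by lia. exact E.
    + intros c Hc T. rewrite xorb_false_l in *. apply (Hu c 0); simpl; auto; try lia.
      apply Nat.ltb_lt. lia.
Qed.

(** * Optimal plays make exactly the true claims *)

Definition best (q : Baire) (a : Cantor) : Cantor := fun k =>
  if k <? count q then
    if excluded_middle_informative (exists t, instances q (slot k t) <> 0)
    then true else false
  else a (k - count q).

Lemma best_claim q a j : j < count q ->
  best q a j = true <-> exists t, instances q (slot j t) <> 0.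
Proof.
  intros Hj. unfold best. destruct (Nat.ltb_spec j (count q)); [|lia].
  destruct (excluded_middle_informative _); split; auto; try discriminate.
Qed.

Lemma best_not_falsified q a : (~ exists t L, lft q t = code a L) -> ~ falsified q (best q a).
Proof.
  intros Ha [(j & Hj & E & H)|(t & L & E)].
  - apply (best_claim q a j Hj) in H. congruence.
  - apply Ha. exists t, L. rewrite E. apply code_ext. intros l _. unfold tail, best.
    destruct (Nat.ltb_spec (count q + l) (count q)); [lia|]. f_equal. lia.
Qed.

(** An unfalsified play makes only true claims, so its claims are among those of [best]. *)
Lemma best_claim_le q a x : ~ falsified q x ->
  forall j, j < count q -> best q a j = true -> x j = true.
Proof.
  intros F j Hj H. apply best_claim in H; auto. destruct (x j) eqn:E; auto.
  exfalso. apply F. left. eauto.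
Qed.

Lemma best_optimal q a x : ~ falsified q (best q a) ->
  val (claim_game q) x <= val (claim_game q) (best q a).
Proof.
  intros Ha. simpl val. destruct (excluded_middle_informative (falsified q x)); [lia|].
  destruct (excluded_middle_informative _); [contradiction|].
  assert (code (best q a) (count q) <= code x (count q)); [|lia].
  apply code_le_mono. apply best_claim_le. assumption.
Qed.

(** The payoff of [best] is positive, which excludes falsification of [x]. The two codes of claims
    then bound each other, and equal codes mean equal claims. *)
Lemma optimal_best q a x : ~ falsified q (best q a) ->
  val (claim_game q) (best q a) <= val (claim_game q) x ->
  ~ falsified q x /\ forall j, j < count q -> x j = best q a j.
Proof.
  intros Ha. simpl val. pose proof (payoff_bounds (best q a) (count q)) as B.
  pose proof (payoff_bounds x (count q)) as B'. simpl in B, B'.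
  destruct (excluded_middle_informative (falsified q (best q a))); [contradiction|].
  destruct (excluded_middle_informative (falsified q x)) as [|F]; [lia|].
  intros H. split; auto. intros j Hj. apply (code_inj _ _ (count q)); auto.
  assert (K : code (best q a) (count q) <= code x (count q))
    by (apply code_le_mono, best_claim_le, F).
  lia.
Qed.

Lemma nash_optimal q s : nash (claim_game q) s ->
  forall x, val (claim_game q) x <= val (claim_game q) (play s).
Proof.
  intros H x. set (s' := (fun w => x (length w)) : strategy).
  assert (E : play s' = x).
  { apply play_unique. intros l. unfold s'. rewrite length_word_code. reflexivity. }
  assert (D : deviation (claim_game q) true s s') by (intros w []; reflexivity).
  apply H in D. rewrite E in D. apply Nat.ltb_ge in D. exact D.
Qed.

Lemma optimal_nash q x : (forall y, val (claim_game q) y <= val (claim_game q) x) ->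
  nash (claim_game q) (fun w => x (length w)).
Proof.
  intros H.
  assert (E : play (fun w => x (length w)) = x).
  { apply play_unique. intros l. rewrite length_word_code. reflexivity. }
  intros [|] s' D; rewrite E.
  - apply Nat.ltb_ge, H.
  (* Player 2 never moves, so its only deviation is the given strategy. *)
  - replace s' with ((fun w => x (length w)) : strategy); [rewrite E; apply Nat.ltb_irrefl|].
    apply functional_extensionality. intros w. symmetry. apply D. discriminate.
Qed.

Lemma play_at_named r s : named strategy_rep r s ->
  forall L, play_at r L = b2n (play s L).
Proof.
  intros Hr L. simpl in Hr.
  assert (H : forall d, 1 <= d -> r (pred d) = b2n (s (word d))) by (intros; apply Hr).
  unfold play_at. set (f := fun _ c => _).
  assert (E : nat_rect (fun _ => nat) 1 f L = code (play s) L).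
  { induction L as [|L IH]; [reflexivity|]. rewrite nat_rect_S, IH. unfold f.
    rewrite H by apply code_pos. simpl code. rewrite <- play_code. reflexivity. }
  rewrite E, H by apply code_pos. rewrite <- play_code. reflexivity.
Qed.

Lemma C_LPO_le_NE : W_le (prod_prob C_Cantor (star LPO)) (NE_ap OA_named).
Proof.
  exists (fun P => Some (read_play P)), (fun q => Some (game_name q)).
  split; [apply computable_total, R_read_play|].
  split; [apply computable_total, R_game_name|].
  intros F HF q [A u] [HA Hu] [[a v] [Ha _]]. simpl in HA, Hu, Ha.
  destruct u as [n xs]. destruct Hu as [Hn Hxs]. simpl in Hn, Hxs.
  change (count q = n) in Hn. subst n.
  pose proof (proj1 (open_named_code _ _) HA) as HA'.
  assert (Hbest : ~ falsified q (best q a)).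
  { apply best_not_falsified. intros E. apply HA' in E. apply E, Ha. }
  destruct (HF (game_name q) (claim_game q)) as (r & Er & s & Hs & Hr).
  { apply game_name_named. }
  { exists (fun w => best q a (length w)). apply optimal_nash. intros y.
    apply best_optimal, Hbest. }
  rewrite Er. eexists. split; [reflexivity|].
  destruct (optimal_best q a (play s) Hbest) as [Hval Heq].
  { apply nash_optimal, Hs. }
  set (out := read_play (join q r)).
  assert (Eout : out = join (fun k => b2n (play s (count q + k)))
    (join (fun _ => count q) (fun y => 1 - b2n (play s (Nat.log2 (S y)))))).
  { unfold out, read_play. rewrite lft_join, rgt_join.
    f_equal; [|f_equal]; apply functional_extensionality; intros y;
      rewrite (play_at_named r s Hr); reflexivity. }
  rewrite Eout.
  destruct (proj1 (pow_LPO_answers (count q) (instances q)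
    (fun y => 1 - b2n (play s (Nat.log2 (S y)))) xs Hxs)) as (ys & Hys & Nys).
  { intros j Hj. rewrite S_slot. simpl Nat.add. rewrite Nat.mul_1_r, Nat.log2_pow2 by lia.
    rewrite Heq by exact Hj. destruct (best q a j) eqn:E.
    - right. split; [reflexivity|]. apply (best_claim q a j Hj), E.
    - left. split; [reflexivity|]. intros t. apply NNPP. intros N.
      apply not_true_iff_false in E. apply E. apply best_claim; eauto. }
  exists (tail (count q) (play s), existT _ (count q) ys). split.
  - split; [|apply (star_intro LPO (count q) xs ys Hys)].
    (* Outside the closed set, an enumerated word would falsify the play. *)
    simpl. apply NNPP. intros N. apply HA' in N. apply Hval. right. exact N.
  - split; simpl; rewrite ?lft_join, ?rgt_join.
    + intros k. reflexivity.
    + split; [reflexivity|exact Nys].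
Qed.

Theorem theorem29 :
  W_equiv (NE_ap OA_named) (prod_prob C_Cantor (star LPO)).
Proof. split; [apply NE_le_C_LPO|apply C_LPO_le_NE]. Qed.
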